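(* Let $n\ge2$, let $\nu\ge2$ be even, and let $\Delta(q,p)$ be an order-$(n,\nu)$ ramified displacement with leading coefficients $c,d$ (defined in the context). Then $$\operatorname{Cyc}_{(0,0)}(\Delta)\le\begin{cases}n,&cd>0,\\ n+1,&cd<0.\end{cases}$$ The bound counts each isolated root once, including a multiple root or a root at the seam $q=0$, and all local zeros are isolated. If $m\ge n$ and $\operatorname{rank}DA(0)=n$, then the applicable bound is attained by simple roots. More precisely, for every $0<r_1<\cdots<r_n$ there is a parameter path $p_t\to0$ (as $t\downarrow0$) such that $\Delta(\cdot,p_t)$ has $n$ negative roots $$q_j(t)=t(-r_j+o(1)),\qquad 1\le j\le n.$$ If $cd<0$, the same path also has a positive root $$q_{\mathrm{ram}}(t)\sim\left(\left|\frac cd\right|\prod_{j=1}^nr_j\right)^{\nu/(\nu+1)}t^{\,n\nu/(\nu+1)}.$$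
   Context: $q_+=\max\{q,0\}$; $p$ ranges near $0\in\mathbb R^m$. An order-$(n,\nu)$ ramified displacement is a germ at $(q,p)=(0,0)$ $$\Delta(q,p)=S(q,p)+q_+^{1+1/\nu}K(q_+^{1/\nu},q,p),$$ where $S$ is jointly $C^{n+1}$, $K(s,q,p)$ is jointly $C^2$ on its one-sided domain $s\ge0$, $\partial_q^jS(0,0)=0$ for $0\le j<n$, $c=\partial_q^nS(0,0)/n!\ne0$, and $d=K(0,0,0)\ne0$. Its coefficient map is $A(p)=(a_0(p),\dots,a_{n-1}(p))$ with $a_j(p)=\partial_q^jS(0,p)/j!$. Local cyclicity: fix a representative on $(-\rho_*,\rho_* )\times V_*$. For an interval $U$ let $N_{\mathrm{iso}}(\Delta(\cdot,p);U)\in\mathbb N_0\cup\{\infty\}$ be the number of distinct isolated real zeros of $q\mapsto\Delta(q,p)$ in $U$. Then $\operatorname{Cyc}_{(0,0)}(\Delta)=\inf_{0<\rho\le\rho_*,\,0\in V\subset V_*}\ \sup_{p\in V}N_{\mathrm{iso}}(\Delta(\cdot,p);(-\rho,\rho))$, with $V$ ranging over neighbourhoods of $0$ in $V_*$. A root is simple if $\Delta_q\neq0$ there. *)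

(* Defs.v *)
From mathcomp Require Import all_boot all_order all_algebra.
From mathcomp Require Import all_classical all_reals all_analysis.

Set Implicit Arguments.
Unset Strict Implicit.
Unset Printing Implicit Defensive.

Import Order.TTheory GRing.Theory Num.Theory.
Import numFieldNormedType.Exports.

Local Open Scope classical_set_scope.
Local Open Scope ring_scope.

(* Derivative of f along v taken inside D: only the increments that stay in D
   are used, so it is one-sided at a boundary point of a half-space when v is
   transverse to the boundary. The filter is proper, hence l is unique, as soon
   as D contains points h *: v + x with h != 0 arbitrarily small; this holds at
   every point of a relatively open subset of a half-space. *)
Definition is_derive_within (R : realType) (V : normedModType R) (D : set V)
    (f : V -> R) (x v : V) (l : R) : Prop :=
  (fun h : R => h^-1 *: (f (h *: v + x) - f x))
    @ within [set h : R | D (h *: v + x)] 0^' --> l.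

(* Joint C^k regularity on D: continuous derivatives (relative to D) of all
   orders up to k. On an open D this is the usual notion. *)
Fixpoint Ck_on (R : realType) (V : normedModType R) (k : nat) (D : set V)
    (f : V -> R) : Prop :=
  {within D, continuous f} /\
  (if k is k'.+1 then
     forall v : V, exists g : V -> R,
       (forall x, D x -> is_derive_within D f x v (g x)) /\ Ck_on k' D g
   else True).

Lemma is_derive_within_open (R : realType) (V : normedModType R) (D : set V)
    (f : V -> R) (x v : V) (l : R) :
  open D -> D x -> is_derive_within D f x v l <-> is_derive x v f l.
Proof.
move=> oD Dx.
have DF : within [set h : R | D (h *: v + x)] 0^' = 0^'.
  have nD : \forall h \near (0 : R), D (h *: v + x).
    have cv : h *: v + x @[h --> (0 : R)] --> (0 : R) *: v + x.
      by apply: cvgD; [apply: cvgZr_tmp; exact: cvg_id | exact: cvg_cst].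
    by apply: cv; rewrite scale0r add0r; exact: open_nbhs_nbhs.
  apply/seteqP; split=> A; rewrite /within /=.
    move=> A0; have : \forall h \near 0^', D (h *: v + x) by exact: nbhs_dnbhs.
    by apply: filterS2 A0 => h; apply.
  by apply: filterS => h Ah _.
rewrite /is_derive_within DF; split=> [fl|dfl].
  apply: DeriveDef; first by apply/cvg_ex; exists l.
  by apply: cvg_lim fl.
by rewrite -(@derive_val _ _ _ x v f l dfl); exact: ex_derive.
Qed.

Definition posp (R : realType) (q : R) : R := Num.max q 0.

(* The coefficient of q^j in the Taylor expansion of S(., p) at q = 0. *)
Definition coefS (R : realType) (m : nat) (S : R -> 'rV[R]_m -> R) (j : nat)
    (p : 'rV[R]_m) : R :=
  derive1n j (S ^~ p) 0 / j`!%:R.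

Definition coefA (R : realType) (m n : nat) (S : R -> 'rV[R]_m -> R)
    (p : 'rV[R]_m) : 'rV[R]_n :=
  \row_(j < n) coefS S j p.

(* Everything is required of germs only: S, K and the formula for Delta are
   constrained on some neighbourhood of the origin. Note that
   0 `^ a = 0 for a != 0. *)
Definition ramified_displacement (R : realType) (m n nu : nat)
    (Delta S : R -> 'rV[R]_m -> R) (K : R -> R -> 'rV[R]_m -> R) : Prop :=
  [/\ \forall x \near ((0, 0) : R * 'rV[R]_m),
        Delta x.1 x.2 = S x.1 x.2 +
          posp x.1 `^ (1 + nu%:R^-1) * K (posp x.1 `^ nu%:R^-1) x.1 x.2,
      exists2 U : set (R * 'rV[R]_m), open_nbhs ((0, 0) : R * 'rV[R]_m) U &
        Ck_on n.+1 U (fun x => S x.1 x.2),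
      exists2 W : set (R * R * 'rV[R]_m), open_nbhs ((0, 0, 0) : R * R * 'rV[R]_m) W &
        Ck_on 2 (W `&` [set x | 0 <= x.1.1]) (fun x => K x.1.1 x.1.2 x.2),
      forall j, (j < n)%N -> derive1n j (S ^~ 0) 0 = 0 &
      coefS S n 0 != 0 /\ K 0 0 0 != 0].

(* The number of isolated zeros of f in U; U is meant to be open, so that
   isolated in U and isolated in the line agree. *)
Definition Niso (R : realType) (f : R -> R) (U : set R) : \bar R :=
  counting (U `&` isolated [set q | f q = 0]).

Definition Cyc (R : realType) (m : nat) (rhos : R) (Vs : set 'rV[R]_m)
    (Delta : R -> 'rV[R]_m -> R) : \bar R :=
  ereal_inf [set N | exists rho : R, exists V : set 'rV[R]_m,
    [/\ 0 < rho <= rhos, nbhs (0 : 'rV[R]_m) V, V `<=` Vs &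
        N = ereal_sup [set Niso (Delta ^~ p) [set q | - rho < q < rho] | p in V]]].

Definition simple_root (R : realType) (f : R -> R) (q : R) : Prop :=
  [/\ f q = 0, derivable f q 1 & derive1 f q != 0].

Definition Nsimple (R : realType) (f : R -> R) (U : set R) : \bar R :=
  counting (U `&` [set q | simple_root f q]).

(* Main.v *)
From HB Require Import structures.
Require Import Defs.
From mathcomp Require Import all_boot all_order all_algebra.
From mathcomp Require Import finmap.
From mathcomp Require Import all_classical all_reals all_analysis.
From mathcomp Require Import ring lra.

(** Fix the parameter [p] near 0. For [q >= 0] put [q = s ^ nu]: the ramified
term becomes [s ^ (nu + 1) * k s] with [k s = K s (s ^ nu) p], which is twice
differentiable for [s > 0], so all fractional powers disappear. Consequently
Delta is differentiable across the seam, with derivative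
[S_q + ((nu + 1) * s * k + s ^ 2 * k') / nu] (lemma [is_derive_displacement]).
As a function of [s] the second summand grows at a rate close to
[(nu + 1) * d / nu], whereas [S_q (s ^ nu)] moves at a rate [O (s ^ (nu - 1))];
hence [d * Delta_q] is strictly increasing on the nonnegative side, uniformly
in [p] ([displacement_slope_increasing]). This is the only property of the
ramified term that the counting needs.

Upper bound. Near the origin the derivative of [S_q] of order [n - 1] has the
sign of [c]. By repeated use of Rolle's theorem, [S_q] has at most [n - 1]
zeros, and it has the sign of [c] to the right of [n - 1] zeros
([sign_beyond_zeros]). As [Delta_q] is [S_q] on the negative side and has at
most one positive zero, it has at most [n] zeros. If it has [n] of them, the
positive one forces [d * S_q 0 < 0] by monotonicity while the [n - 1] others
force [c * S_q 0 > 0], so that [c * d < 0] ([size_zeros_seam]). One more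
application of Rolle's theorem bounds the zeros of Delta by [n], or by [n + 1]
when [c * d < 0]; finiteness makes them isolated.

Attainment. The rank condition makes the coefficient map a submersion at 0:
since it is continuously differentiable it is strictly differentiable, and the
contraction principle gives a Lipschitz right inverse ([submersion_section]).
One can therefore choose [p_t] such that the Taylor coefficients of [S] of
order less than [n] are those of [c * \prod_j (q + t * r_j)]. By Taylor's
formula, [S (t * x, p_t) = c * t ^ n * (\prod_j (x + r_j) + o(1))]
([path_expansion]), and sign changes at [- r_j +- eta] give [n] negative roots.
They are simple, because a zero of [S_q] at one of them, together with the
[n - 1] zeros given by Rolle's theorem, would be one zero too many
([simple_of_size_zeros]).

If [c * d < 0], let [g t] be the announced equivalent of the positive root. The
terms [c * t ^ n * \prod_j r_j] of [S] and [d * q ^ (1 + 1 / nu)] have opposite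
signs and balance at [q = g t]; precisely, Delta at [mu * g t] is
[c * t ^ n * \prod_j r_j * (1 - mu ^ (1 + 1 / nu) + o(1))] ([ramified_value]),
so that there is a root between [(1 - e) * g t] and [(1 + e) * g t] for every
[e]. As [d * Delta_q] is increasing and [d * Delta 0 < 0], the positive root is
unique and simple ([ramified_root_unique]); hence it is equivalent to [g t]. *)

Set Implicit Arguments.
Unset Strict Implicit.
Unset Printing Implicit Defensive.

Import Order.TTheory GRing.Theory Num.Theory.
Import numFieldNormedType.Exports.

Local Open Scope classical_set_scope.
Local Open Scope ring_scope.

(** * Derivatives and neighbourhoods on the real line *)

Lemma is_derive_cont (R : realType) (f : R -> R) (x l : R) :
  is_derive x 1 f l -> {for x, continuous f}.
Proof.
by move=> df; apply/differentiable_continuous/derivable1_diffP; exact: ex_derive.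
Qed.

Lemma MVT_interior (R : realType) (f df : R -> R) (a b : R) : a < b ->
  (forall x, a <= x <= b -> is_derive x 1 f (df x)) ->
  exists2 x, a < x < b & f b - f a = df x * (b - a).
Proof.
move=> ab fd.
have [||x xab e] := @MVT R f df a b ab.
- by move=> x; rewrite in_itv/= => /andP[ax xb]; apply: fd; rewrite !ltW.
- apply: continuous_in_subspaceT => x; rewrite inE/= in_itv/= => xab.
  exact: is_derive_cont (fd _ xab).
by exists x.
Qed.

Lemma near_pair0 (R : realType) (V W : normedModType R) (P : V * W -> Prop) :
  (\forall x \near (0, 0), P x) ->
  exists2 e : R, 0 < e & forall v w, `|v| < e -> `|w| < e -> P (v, w).
Proof.
move=> [[A B] [/= /nbhs_norm0P[e e0 eA] /nbhs_norm0P[e' e'0 eB]] AB].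
exists (Num.min e e'); first by rewrite lt_min e0 e'0.
move=> v w; rewrite !lt_min => /andP[ve _] /andP[_ we].
by apply: AB; split => /=; [exact: eA|exact: eB].
Qed.

Lemma near0_norm_lt (R : realType) (V : normedModType R) (e : R) :
  0 < e -> \forall x \near (0 : V), `|x| < e.
Proof. by move=> e0; apply/nbhs_norm0P; exists e. Qed.

(** The form in which derivatives are established below: it makes sense at the
seam, where the two sides are estimated together. *)
Lemma is_derive_eps (R : realType) (f : R -> R) (a l : R) :
  (forall e, 0 < e -> \forall h \near (0 : R), `|f (h + a) - f a - l * h| <= e * `|h|) ->
  is_derive a 1 f l.
Proof.
move=> H.
have cv : (fun h : R => h^-1 *: (f (h *: (1 : R) + a) - f a)) @ 0^' --> l.
  apply/cvgrPdist_le => e e0; near=> h.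
  have h0 : h != 0 by near: h; exact: nbhs_dnbhs_neq.
  have -> : l - h^-1 *: (f (h *: (1 : R) + a) - f a) =
      - (h^-1 * (f (h + a) - f a - l * h)).
    by rewrite /GRing.scale /= mulr1; field.
  rewrite normrN normrM normfV mulrC ler_pdivrMr ?normr_gt0//.
  by near: h; apply: nbhs_dnbhs; exact: H.
apply: DeriveDef; first by apply/cvg_ex; exists l.
by apply: cvg_lim cv.
Unshelve. all: by end_near. Qed.

Lemma is_derive_eps_inv (R : realType) (f : R -> R) (a l : R) :
  is_derive a 1 f l ->
  forall e, 0 < e -> \forall h \near (0 : R), `|f (h + a) - f a - l * h| <= e * `|h|.
Proof.
move=> fl e e0.
have cv : (fun h : R => h^-1 *: (f (h *: (1 : R) + a) - f a)) @ 0^' --> l.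
  by rewrite -(@derive_val _ _ _ a 1 f l fl); exact: ex_derive.
move/cvgrPdist_le : cv => /(_ e e0) /nbhs_ballP[r /= r0 rH].
apply/nbhs_norm0P; exists r => //= h hr.
have [->|h0] := eqVneq h 0; first by rewrite add0r subrr mulr0 subr0 !normr0 mulr0.
have := rH h; rewrite /ball /= sub0r normrN => /(_ hr h0).
have -> : f (h + a) - f a - l * h =
    - ((l - h^-1 *: (f (h *: (1 : R) + a) - f a)) * h).
  by rewrite /GRing.scale /= mulr1; field.
by rewrite normrN normrM => ?; rewrite ler_wpM2r.
Qed.

(** Reduces directional derivatives to derivatives of functions of one real
variable, to which the mean value theorem applies. *)
Lemma is_derive_line (R : realType) (V : normedModType R) (f : V -> R)
    (x y v : V) (t l : R) : x = t *: v + y ->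
  is_derive x v f l -> is_derive t 1 (fun h => f (h *: v + y)) l.
Proof.
move=> -> fl.
have E : (fun h : R => h^-1 *: (f ((h *: 1 + t) *: v + y) - f (t *: v + y))) =
    (fun h : R => h^-1 *: (f (h *: v + (t *: v + y)) - f (t *: v + y))).
  by apply/funext => h; rewrite (mulr1 h : h *: (1 : R) = h) scalerDl addrA.
apply: DeriveDef.
  by have := @ex_derive _ _ _ _ _ _ _ fl; rewrite /derivable /= -E.
by rewrite -(@derive_val _ _ _ _ _ _ _ fl) /derive /= -E.
Qed.

Lemma MVT_between (R : realType) (f df : R -> R) (a b : R) :
  (forall x, Num.min a b <= x <= Num.max a b -> is_derive x 1 f (df x)) ->
  exists2 x, Num.min a b <= x <= Num.max a b & f b - f a = df x * (b - a).
Proof.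
have [ab|ba|<-] := ltgtP a b => fd.
- have [x /andP[ax xb] e] := MVT_interior ab fd.
  by exists x => //; rewrite !ltW.
- have [x /andP[ax xb] e] := MVT_interior ba fd.
  exists x; first by rewrite !ltW.
  by rewrite -opprB e -mulrN opprB.
- by exists a; rewrite ?lexx// !subrr mulr0.
Qed.

Lemma between_dist (R : realType) (a b x : R) :
  Num.min a b <= x <= Num.max a b -> `|x - a| <= `|b - a|.
Proof.
have [ab|ba|<-] := ltgtP a b => /andP[ax xb].
- by rewrite !ger0_norm ?subr_ge0 ?(ltW ab)// lerD2r.
- by rewrite !ler0_norm ?subr_le0 ?(ltW ba)// lerN2 lerD2r.
- by rewrite (le_anti (_ : x <= a <= x)) ?subrr ?normr0// xb.
Qed.

Lemma between_norm_lt (R : realType) (a b x s : R) : `|a| < s -> `|b| < s ->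
  Num.min a b <= x <= Num.max a b -> `|x| < s.
Proof.
rewrite !ltr_norml => /andP[a1 a2] /andP[b1 b2] /andP[x1 x2].
by rewrite (lt_le_trans _ x1) ?lt_min ?a1//= (le_lt_trans x2)// gt_max a2.
Qed.

(** A chain rule along the graph of [y] under mixed assumptions: the partial
derivative in the first variable has to be continuous at the point, while in
the second one differentiability at the point is enough. The increment is split
into a horizontal part, handled by the mean value theorem, and a vertical part,
handled by composition. *)
Lemma is_derive_curve (R : realType) (f fx : R -> R -> R) (y : R -> R)
    (a fy y' : R) :
  (\forall z \near ((a, y a) : R * R), is_derive (z.1 : R) (1 : R) (f ^~ (z.2 : R)) (fx z.1 z.2)) ->
  {for (a, y a), continuous (fun z : R * R => fx z.1 z.2)} ->
  is_derive (y a) 1 (f a) fy -> is_derive a 1 y y' ->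
  is_derive a 1 (fun s => f s (y s)) (fx a (y a) + fy * y').
Proof.
move=> fd fc fyd yd.
have E : (fun s => f s (y s)) = (fun s => f s (y s) - f a (y s)) + (f a \o y).
  by apply/funext => s /=; rewrite /GRing.add /= subrK.
rewrite E.
have D2 : is_derive a 1 (f a \o y) (fy * y') by exact: is_derive1_comp.
suff D1 : is_derive a 1 (fun s => f s (y s) - f a (y s)) (fx a (y a)).
  exact: is_deriveD.
apply: is_derive_eps => e e0.
move/cvgrPdist_le : fc => /(_ e e0) fc.
have [r r0 rH] : exists2 r : R, 0 < r & forall x z, `|x - a| < r -> `|z - y a| < r ->
    is_derive x 1 (f ^~ z) (fx x z) /\ `|fx a (y a) - fx x z| <= e.
  have : \forall z \near ((a, y a) : R * R),
     is_derive (z.1 : R) (1 : R) (f ^~ (z.2 : R)) (fx z.1 z.2)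
     /\ `|fx a (y a) - fx z.1 z.2| <= e.
    near=> z; split; near: z; [exact: fd|exact: fc].
  move=> /nbhs_ballP[r /= r0 rH]; exists r => // x z xa za.
  by apply: (rH (x, z)); split; rewrite /ball /= distrC.
have yc := is_derive_cont yd.
have yn : \forall h \near (0 : R), `|y (h + a) - y a| < r.
  move/cvgrPdist_lt : yc => /(_ r r0) /nbhs_ballP[r' /= r'0 r'H].
  apply/nbhs_norm0P; exists r' => //= h hr; rewrite distrC; apply: r'H.
  by rewrite /ball /= opprD addrCA subrr addr0 normrN.
have hn : \forall h \near (0 : R), `|h| < r by exact: near0_norm_lt.
near=> h.
have hr : `|h| < r by near: h.
have yr : `|y (h + a) - y a| < r by near: h.
have [x xab Ex] := @MVT_between R (f ^~ (y (h + a))) (fx ^~ (y (h + a))) a (h + a)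
  (fun x xab => proj1 (rH x _ (le_lt_trans (between_dist xab)
     (etrans (congr1 (fun u => `|u| < r) (addrK a h)) hr)) yr)).
rewrite Ex subrr subr0 addrK -mulrBl normrM ler_wpM2r// distrC.
by apply: (rH x _ _ yr).2; rewrite (le_lt_trans (between_dist xab))// addrK.
Unshelve. all: by end_near. Qed.

Lemma is_derive_exprn (R : realType) (n : nat) (x : R) :
  is_derive x 1 (fun s => s ^+ n) (n%:R * x ^+ n.-1).
Proof.
have := @is_derive_poly R 'X^n x.
have -> : horner ('X^n : {poly R}) = (fun s => s ^+ n).
  by apply/funext => s; rewrite hornerXn.
by rewrite derivXn hornerMn hornerXn -mulr_natl.
Qed.

Lemma IVT_root (R : realType) (f df : R -> R) (a b : R) : a <= b ->
  (forall x, a <= x <= b -> is_derive x 1 f (df x)) -> f a * f b <= 0 ->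
  exists2 x, a <= x <= b & f x = 0.
Proof.
move=> ab fd fab.
have [||x] := @IVT R f a b 0 ab.
- apply: continuous_in_subspaceT => x; rewrite inE/= in_itv/= => xab.
  exact: is_derive_cont (fd _ xab).
- rewrite ge_min le_max; case: (ltgtP (f a) 0) fab => fa /=; last by [].
    by rewrite nmulr_rle0// => ->; rewrite ?orbT.
  by rewrite pmulr_rle0// => ->; rewrite ?orbT.
by rewrite in_itv /= => xab fx; exists x.
Qed.

Lemma near_right0P (R : realType) (P : R -> Prop) :
  (exists2 e : R, 0 < e & forall t, 0 < t < e -> P t) <-> \forall t \near 0^'+, P t.
Proof.
split=> [[e e0 eP]|].
  near=> t; apply: eP; apply/andP; split; [by near: t; exact: nbhs_right_gt|].
  by near: t; exact: nbhs_right_lt.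
move=> /nbhs_ballP[e /= e0 eP]; exists e => // t /andP[t0 te]; apply: eP => //.
by rewrite /ball /= sub0r normrN gtr0_norm.
Unshelve. all: by end_near. Qed.

(** * Counting zeros with Rolle's theorem *)

Lemma path_le_last (R : realType) (x : R) (s : seq R) :
  path <%R x s -> {in x :: s, forall y, y <= last x s}.
Proof.
elim: s x => [|u s IH] x /=; first by move=> _ y; rewrite inE => /eqP->.
move=> /andP[xu us] y; rewrite inE => /orP[/eqP->|]; last exact: IH.
by rewrite (le_trans (ltW xu))//; apply: IH => //; rewrite mem_head.
Qed.

Section rolle.
Variables (R : realType) (a b : R).
Implicit Types (f : R -> R) (F : nat -> R -> R) (x y : R) (s w : seq R).

Definition zeros_in f s := all (fun y => (a < y < b) && (f y == 0)) s.

(** Rolle's theorem for an increasing list of zeros. That the new zeros avoid the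
old ones is what makes the count of [simple_of_size_zeros] work. *)
Lemma rolle_path f f1 x s :
  (forall y, a < y < b -> is_derive y 1 f (f1 y)) ->
  path <%R x s -> zeros_in f (x :: s) ->
  exists w, [/\ path <%R x w, size w = size s, zeros_in f1 w,
    {in w, forall y, exists2 z, z \in s & y < z}
    & {in w, forall y, y \notin x :: s}].
Proof.
move=> fd; elim: s x => [|y s IH] x /=; first by move=> _ _; exists [::].
move=> /andP[xy ys] /andP[/andP[xab fx]] /andP[/andP[yab fy] sab].
have [|w [yw sw w0 wl wn]] := IH y ys; first by rewrite /= yab fy.
have zin z : x <= z <= y -> a < z < b.
  move=> /andP[xz zy]; move: xab yab => /andP[ax _] /andP[_ yb].
  by rewrite (lt_le_trans ax xz) (le_lt_trans zy yb).
have [z /andP[xz zy]] : exists2 z, x < z < y & f y - f x = f1 z * (y - x).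
  by apply: MVT_interior => // z /zin; exact: fd.
rewrite (eqP fx) (eqP fy) subrr => /esym/eqP.
rewrite mulf_eq0 subr_eq0 (gt_eqF xy) orbF => f1z.
have sy : all (> y) s by apply: order_path_min ys; exact: lt_trans.
have wy : all (> y) w by apply: order_path_min yw; exact: lt_trans.
exists (z :: w); split => /=.
- by rewrite xz; case: (w) wy yw => //= u w' /andP[yu _] /andP[_ ->];
     rewrite (lt_trans zy yu).
- by rewrite sw.
- by rewrite f1z zin ?ltW.
- move=> u; rewrite inE => /orP[/eqP->|/wl[v vs uv]].
    by exists y => //; rewrite mem_head.
  by exists v => //; rewrite inE vs orbT.
- move=> u; rewrite inE => /orP[/eqP->|uw].
    rewrite !inE !negb_or gt_eqF// lt_eqF//=.
    by apply/negP => /(allP sy)/ltW/(lt_le_trans zy); rewrite ltxx.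
  rewrite inE negb_or wn// andbT gt_eqF//.
  by rewrite (lt_trans xy)// (allP wy).
Qed.

Definition derive_chain F k :=
  forall i x, (i < k)%N -> a < x < b -> is_derive x 1 (F i) (F i.+1 x).

Lemma derive_chainS F k :
  derive_chain F k.+1 -> derive_chain (fun i => F i.+1) k.
Proof. by move=> Fd i x ik; exact: Fd. Qed.

(** The qualitative content of the interpolation formula
[F 0 x = F k xi / k! * \prod_i (x - s_i)]: by induction the derivative has the
sign of [c] after the last zero, so [F 0] leaves that zero in this direction. *)
Lemma sign_beyond_zeros F k c s x :
  derive_chain F k -> (forall y, a < y < b -> 0 < c * F k y) ->
  sorted <%R s -> zeros_in (F 0%N) s -> size s = k ->
  a < x < b -> {in s, forall y, y < x} -> 0 < c * F 0%N x.
Proof.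
elim: k F s x => [|k IH] F s x Fd Fk; first by move=> _ _ _ xab _; exact: Fk.
case: s => [|z s] // zs z0 /eqP; rewrite eqSS => /eqP sk xab sx; rewrite /= in zs.
have [|w [zw ws w0 wl _]] := @rolle_path _ (F 1%N) _ _ _ zs z0; first by move=> y; exact: Fd.
(* By induction [F 1] has the sign of [c] after [l], hence [F 0] moves in
   this direction from its value 0 at [l]. *)
set l := last z s.
have lx : l < x by apply: sx; exact: mem_last.
have [lab Fl] : a < l < b /\ F 0%N l = 0.
  by have /andP[-> /eqP] := allP z0 _ (mem_last z s).
have sl : {in z :: s, forall y, y <= l} by exact: path_le_last.
have [u /andP[lu ux]] : exists2 u, l < u < x & F 0%N x - F 0%N l = F 1%N u * (x - l).
  apply: MVT_interior => // u /andP[lu ux]; apply: Fd => //.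
  move: lab xab => /andP[al _] /andP[_ xb].
  by rewrite (lt_le_trans al lu) (le_lt_trans ux xb).
rewrite Fl subr0 => ->; rewrite mulrA mulr_gt0 ?subr_gt0//.
apply: (IH (fun i => F i.+1) w) => //.
- exact: derive_chainS.
- exact: path_sorted zw.
- by rewrite ws.
- move: lab xab => /andP[al _] /andP[_ xb].
  by rewrite (lt_trans al lu) (lt_trans ux xb).
- move=> y /wl[v vs yv]; rewrite (lt_trans yv)// (le_lt_trans _ lu)//.
  by apply: sl; rewrite inE vs orbT.
Qed.

(** Otherwise [sign_beyond_zeros], applied to the first [k] zeros, would forbid
the next one. *)
Lemma size_zeros_le F k c s :
  derive_chain F k -> (forall y, a < y < b -> 0 < c * F k y) ->
  sorted <%R s -> zeros_in (F 0%N) s -> (size s <= k)%N.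
Proof.
move=> Fd Fk ss s0; rewrite leqNgt; apply/negP => ks.
have := @sign_beyond_zeros F k c (take k s) s`_k Fd Fk.
have sk0 := allP s0 _ (mem_nth 0 ks).
case/andP: sk0 => kab /eqP ->; rewrite mulr0 ltxx => H.
suff: false by []. apply: H => //.
- exact: take_sorted.
- by apply/allP => y /mem_take; exact: (allP s0).
- by rewrite size_take ks.
- move=> y /(nthP 0)[i]; rewrite size_take ks => ik <-.
  rewrite nth_take//; apply: (sorted_ltn_nth lt_trans) => //.
  by rewrite inE (ltn_trans ik).
Qed.

(** A multiple zero would be, besides the [k] zeros of [F 1] provided by Rolle's
theorem, a zero of [F 1] number [k + 1]. *)
Lemma simple_of_size_zeros F k c s :
  derive_chain F k.+1 -> (forall y, a < y < b -> 0 < c * F k.+1 y) ->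
  sorted <%R s -> zeros_in (F 0%N) s -> size s = k.+1 ->
  {in s, forall y, F 1%N y != 0}.
Proof.
move=> Fd Fk; case: s => [|z s] // zs z0 /eqP; rewrite eqSS => /eqP sk y ys.
rewrite /= in zs; apply/negP => F1y.
have [|w [zw ws w0 _ wn]] := @rolle_path _ (F 1%N) _ _ _ zs z0; first by move=> x; exact: Fd.
have wy : y \notin w by apply/negP => /wn/negP; exact.
have := @size_zeros_le (fun i => F i.+1) k c (sort <=%R (y :: w))
  (derive_chainS Fd) Fk.
rewrite size_sort [size _]/= ws (sk : size s = k) ltnn => H; suff: false by []. apply: H.
  rewrite sort_lt_sorted /= wy /=.
  by have := path_sorted zw; rewrite lt_sorted_uniq_le => /andP[].
apply/allP => u; rewrite mem_sort inE => /orP[/eqP->|uw].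
  by rewrite F1y andbT; case/andP: (allP z0 _ ys).
exact: (allP w0).
Qed.

(** The function [g] is the derivative of the displacement, [F 0] that of the
smooth part. The zeros of [g] on the left are zeros of [F 0]; monotonicity
leaves room for one zero on the right. If both counts are maximal, then [F 0] at
the seam has the sign of [c] by [sign_beyond_zeros] and the sign of [- d] by
monotonicity. *)
Lemma size_zeros_seam F k c d g s : a < 0 -> 0 < b ->
  derive_chain F k -> (forall y, a < y < b -> 0 < c * F k y) ->
  (forall y, a < y <= 0 -> g y = F 0%N y) ->
  (forall x y, 0 <= x -> x < y -> y < b -> 0 < d * (g y - g x)) ->
  sorted <%R s -> zeros_in g s -> (size s <= ~~ (0 < c * d)%R + k)%N.
Proof.
move=> a0 b0 Fd Fk gF gd ss s0.
(* The zeros are split at the seam; the seam itself goes to the left. *)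
pose s1 := [seq y <- s | y <= 0]; pose s2 := [seq y <- s | ~~ (y <= 0)].
have es : size s = (size s2 + size s1)%N.
  by rewrite !size_filter addnC (count_predC (fun y => y <= 0)).
have ss1 : sorted <%R s1 by apply: sorted_filter => //; exact: lt_trans.
have ss2 : sorted <%R s2 by apply: sorted_filter => //; exact: lt_trans.
have s10 : zeros_in (F 0%N) s1.
  apply/allP => y; rewrite mem_filter => /andP[y0] /(allP s0)/andP[/andP[ay yb]].
  by rewrite gF ?ay ?yb.
have s20 : {in s2, forall y, [/\ 0 < y, y < b & g y = 0]}.
  move=> y; rewrite mem_filter -ltNge => /andP[y0] /(allP s0)/andP[/andP[ay yb]].
  by move/eqP.
have n1 : (size s1 <= k)%N by exact: (size_zeros_le Fd Fk).
rewrite es.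
case: s2 ss2 s20 {es} => [|y [|z s2]] ss2 s20; first by rewrite /= add0n (leq_trans n1)// leq_addl.
  case: ltP => cd; last by rewrite leq_add2l.
  rewrite /= add1n add0n; move: n1; rewrite leq_eqVlt => /orP[/eqP n1|//].
  have [y0 yb gy] := s20 y (mem_head _ _).
  have := gd 0 y (lexx _) y0 yb; rewrite gy sub0r.
  have g0 : g 0 = F 0%N 0 by apply: gF; rewrite a0 lexx.
  rewrite g0 mulrN oppr_gt0 => dF0.
  have cF0 : 0 < c * F 0%N 0.
    apply: (sign_beyond_zeros Fd Fk ss1 s10 n1); first by rewrite a0.
    move=> u u1; have := allP s10 _ u1; case/andP=> _ /eqP Fu.
    move: u1; rewrite mem_filter le_eqVlt => /andP[/orP[/eqP u0|//] _].
    by move: dF0; rewrite u0 in Fu; rewrite Fu mulr0 ltxx.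
  have := mulr_gt0 cF0 (_ : 0 < - (d * F 0%N 0)); rewrite oppr_gt0 => /(_ dF0).
  have -> : c * F 0%N 0 * - (d * F 0%N 0) = - ((c * d) * F 0%N 0 ^+ 2) by ring.
  by rewrite oppr_gt0 ltNge mulr_ge0 ?sqr_ge0// ltW.
have [y0 _ gy] := s20 y (mem_head _ _).
have [_ zb gz] : [/\ 0 < z, z < b & g z = 0] by apply: s20; rewrite !inE eqxx orbT.
move: ss2 => /= /andP[yz _].
by have := gd y z (ltW y0) yz zb; rewrite gy gz subrr mulr0 ltxx.
Qed.

Lemma size_zeros_ramified f F k c d g s : a < 0 -> 0 < b ->
  derive_chain F k -> (forall y, a < y < b -> 0 < c * F k y) ->
  (forall y, a < y < b -> is_derive y 1 f (g y)) ->
  (forall y, a < y <= 0 -> g y = F 0%N y) ->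
  (forall x y, 0 <= x -> x < y -> y < b -> 0 < d * (g y - g x)) ->
  sorted <%R s -> zeros_in f s -> (size s <= ~~ (0 < c * d)%R + k.+1)%N.
Proof.
move=> a0 b0 Fd Fk fg gF gd; case: s => // x s xs s0; rewrite addnS ltnS.
have [w [xw sw w0 _ _]] := rolle_path fg xs s0.
by have := size_zeros_seam a0 b0 Fd Fk gF gd (path_sorted xw) w0; rewrite sw.
Qed.

End rolle.

(** Iterated mean value theorem: Taylor's estimate up to the factor [1 / n!]. *)
Lemma chain_vanishing_bound (R : realType) (n : nat) (h : nat -> R -> R) (rho e : R) :
  (forall j (q : R), (j < n)%N -> `|q| < rho -> is_derive q 1 (h j) (h j.+1 q)) ->
  (forall j, (j < n)%N -> h j 0 = 0) ->
  (forall q, `|q| < rho -> `|h n q| <= e) ->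
  forall q, `|q| < rho -> `|h 0%N q| <= e * `|q| ^+ n.
Proof.
elim: n h => [|n IH] h hd h0 hn q qr; first by rewrite expr0 mulr1 hn.
have inb x : Num.min 0 q <= x <= Num.max 0 q -> `|x| < rho.
  by apply: between_norm_lt => //; rewrite normr0 (le_lt_trans _ qr).
have [x xq] := @MVT_between R (h 0%N) (h 1%N) 0 q (fun x xq => hd 0%N x isT (inb x xq)).
rewrite h0// !subr0 => ->; rewrite normrM exprSr mulrA ler_wpM2r//.
have := IH (fun j => h j.+1) (fun j q jn => hd j.+1 q jn) (fun j jn => h0 j.+1 jn) hn x (inb x xq).
move=> /le_trans; apply; rewrite ler_wpM2l//.
  by apply: le_trans (hn q qr).
by apply: lerXn2r; rewrite ?nnegrE//; have := between_dist xq; rewrite !subr0.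
Qed.

(** Stated for an arbitrary polynomial with the prescribed derivatives at 0,
because it will be applied to a rescaled product of linear factors; the
coefficient of order [n] only has to approximate [f n / n!]. *)
Lemma taylor_poly (R : realType) (n : nat) (f : nat -> R -> R) (T : {poly R}) (rho e : R) :
  (forall j (q : R), (j < n)%N -> `|q| < rho -> is_derive q 1 (f j) (f j.+1 q)) ->
  (size T <= n.+1)%N -> (forall j, (j < n)%N -> f j 0 = j`!%:R * T`_j) ->
  (forall q, `|q| < rho -> `|f n q - n`!%:R * T`_n| <= e) ->
  forall q, `|q| < rho -> `|f 0%N q - T.[q]| <= e * `|q| ^+ n.
Proof.
move=> fd sT f0 fn q qr.
have T0 j : (T^`(j))`_0 = j`!%:R * T`_j.
  by rewrite coef_derivn addn0 ffactnn mulr_natl.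
pose h j q := f j q - (T^`(j)).[q].
have hd j (x : R) : (j < n)%N -> `|x| < rho -> is_derive x 1 (h j) (h j.+1 x).
  move=> jn xr; have dT : is_derive x 1 (horner T^`(j)) (T^`(j.+1)).[x].
    by rewrite derivnS; exact: is_derive_poly.
  exact: (is_deriveB (fd j x jn xr) dT).
have h0 j : (j < n)%N -> h j 0 = 0.
  by move=> jn; rewrite /h horner_coef0 T0 f0// subrr.
have hn x : `|x| < rho -> `|h n x| <= e.
  move=> xr; have sTn : (size (T^`(n)) <= 1)%N.
    apply/leq_sizeP => j j1; rewrite coef_derivn nth_default ?mul0rn//.
    by rewrite (leq_trans sT)// -addn1 leq_add2l.
  by rewrite /h (size1_polyC sTn) hornerC T0; exact: fn.
by have := chain_vanishing_bound hd h0 hn qr; rewrite /h derivn0.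
Qed.

(** * Cardinality of zero sets *)

Lemma sort_fset_mem (R : realType) (B : {fset R}) (A : set R) :
  [set` B] `<=` A -> exists s : seq R,
  [/\ sorted <%R s, {in s, forall x, A x} & size s = #|` B|%fset].
Proof.
move=> BA; exists (sort <=%R (enum_fset B)); split.
- by rewrite sort_lt_sorted fset_uniq.
- by move=> x; rewrite mem_sort => xB; exact: BA.
- by rewrite size_sort.
Qed.

(** The bound on lists also excludes infinite sets, which contain finite sets of
every cardinality. *)
Lemma counting_le (R : realType) (A : set R) (N : nat) :
  (forall s, sorted <%R s -> {in s, forall x, A x} -> (size s <= N)%N) ->
  finite_set A /\ ((counting A : \bar R) <= N%:R%:E)%E.
Proof.
move=> H; have fA : finite_set A.
  apply: contrapT => /(infinite_set_fset N.+1)[B /sort_fset_mem[s [ss sA sB]]].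
  by rewrite -sB ltnNge H.
split=> //; rewrite /counting asboolT// lee_fin ler_nat.
have [s [ss sA <-]] := @sort_fset_mem R (fset_set A) A (fun x => 
  (fun h => set_mem (etrans (esym (in_fset_set fA x)) h))).
exact: H.
Qed.

Lemma counting_ge (R : realType) (A : set R) (s : seq R) :
  uniq s -> {in s, forall x, A x} -> ((size s)%:R%:E <= (counting A : \bar R))%E.
Proof.
move=> us sA; rewrite /counting; case: asboolP => fA; last exact: leey.
rewrite lee_fin ler_nat.
have -> : size s = #|` [fset x in s]%fset|%fset.
  by rewrite card_fseq undup_id.
apply: fsubset_leq_card; apply/fsubsetP => x; rewrite in_fset /= => xs.
by rewrite in_fset_set// mem_set//; exact: sA.
Qed.

Lemma counting_mono (R : realType) (A B : set R) : A `<=` B ->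
  ((counting A : \bar R) <= counting B)%E.
Proof.
move=> AB; rewrite {2}/counting; case: asboolP => fB; last exact: leey.
have fA := sub_finite_set AB fB.
rewrite /counting asboolT// lee_fin ler_nat; apply: fsubset_leq_card.
by apply/fsubsetP => x; rewrite !in_fset_set// !inE; exact: AB.
Qed.

Lemma simple_root_isolated (R : realType) (f : R -> R) (q : R) :
  simple_root f q -> isolated [set x | f x = 0] q.
Proof.
move=> [fq fd f'q]; split; first by rewrite inE.
have df : is_derive q 1 f (derive1 f q) by rewrite derive1E; exact/derivableP.
have l0 : 0 < `|derive1 f q| / 2 by rewrite divr_gt0// normr_gt0.
have /nbhs_norm0P[e /= e0 eH] := is_derive_eps_inv df l0.
exists (ball q e); first exact: nbhsx_ballx.
apply/seteqP; split => [x [/= qx fx]|x /= ->]; last by split => //; exact: ballxx.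
apply/eqP; rewrite -subr_eq0; apply/negPn/negP => xq.
have := eH (x - q); rewrite /= distrC => /(_ qx).
rewrite subrK fx fq subrr sub0r normrN normrM -mulrA ler_pM2l ?normr_gt0//.
by apply/negP; rewrite -ltNge (distrC q x) gtr_pMl ?normr_gt0// invf_lt1// ltr1n.
Qed.

Lemma finite_isolated (R : realType) (Z : set R) (a b q : R) : a < q < b ->
  finite_set (Z `&` [set x | a < x < b]) -> Z q -> isolated Z q.
Proof.
move=> /andP[aq qb] fZ Zq; split; first by rewrite inE.
have cB : closed ((Z `&` [set x | a < x < b]) `\ q).
  have /accessible_finite_set_closed := @hausdorff_accessible R (@norm_hausdorff R R).
  by apply; exact: finite_setD.
exists (`]a, b[%classic `&` ~` ((Z `&` [set x | a < x < b]) `\ q)).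
  apply: filterI.
    by apply: open_nbhs_nbhs; split; [exact: interval_open|rewrite /= in_itv /= aq].
  by apply: open_nbhs_nbhs; split; [exact: closed_openC|move=> [_]; exact].
apply/seteqP; split => [x [[/=]]|x /= ->].
  rewrite in_itv /= => xab xn Zx; apply: contrapT => xq; apply: xn.
  by split.
split=> //; split; first by rewrite /= in_itv /= aq.
by move=> [_]; exact.
Qed.

(** * Derivatives extracted from joint regularity *)

Section regularity.
Variables (R : realType) (V : normedModType R).
Implicit Types (D : set V) (f : V -> R) (x v : V).

Lemma is_derive_within_interior D f x v l :
  nbhs x D -> is_derive_within D f x v l -> is_derive x v f l.
Proof.
move=> xD; have [U /= oU UD] : exists2 U : set V, open_nbhs x U & U `<=` D.
  by move: xD; rewrite nbhsE => -[U ? ?]; exists U.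
move=> fl; apply/(is_derive_within_open f v l oU.1 oU.2).
apply: cvg_trans fl; apply: cvg_app => A DA.
have {}DA : \forall h \near (0 : R)^', D (h *: v + x) -> A h by [].
suff: \forall h \near (0 : R)^', U (h *: v + x) -> A h by [].
by apply: filterS DA => h AD /UD; exact: AD.
Qed.

Lemma Ck_on_cont D k f : Ck_on k D f -> {within D, continuous f}.
Proof. by case: k => [|k] []. Qed.

Lemma Ck_on_cont_interior D k f x :
  Ck_on k D f -> nbhs x D -> {for x, continuous f}.
Proof.
move=> /Ck_on_cont fc xD; have [U oU UD] : exists2 U : set V, open_nbhs x U & U `<=` D.
  by move: xD; rewrite nbhsE => -[U ? ?]; exists U.
have := continuous_subspaceW UD fc.
by rewrite (continuous_open_subspace _ oU.1); apply; rewrite inE; exact: oU.2.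
Qed.

Lemma Ck_on_near D k f x e : Ck_on k D f -> D x -> 0 < e ->
  \forall y \near x, D y -> `|f x - f y| < e.
Proof.
move=> /Ck_on_cont/subspace_continuousP fc Dx e0.
by have /cvgrPdist_lt/(_ e e0) := fc x Dx.
Qed.

Lemma Ck_onW D k f : Ck_on k.+1 D f -> Ck_on k D f.
Proof.
elim: k f => [|k IH] f []; first by move=> fc _; split.
move=> fc fd; split=> // v; have [g [fg gk]] := fd v.
by exists g; split=> //; exact: IH.
Qed.

Lemma Ck_on_le D k l f : (k <= l)%N -> Ck_on l D f -> Ck_on k D f.
Proof.
by move=> /subnK <-; elim: (_ - _)%N => // j IH; rewrite addSn => /Ck_onW.
Qed.

(** Iterated derivatives in a single direction, each with the regularity that
remains. *)
Lemma Ck_on_chain D k f v : Ck_on k D f ->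
  exists2 F : nat -> V -> R, F 0%N = f & forall j, (j <= k)%N ->
    Ck_on (k - j) D (F j) /\
    ((j < k)%N -> forall x, D x -> is_derive_within D (F j) x v (F j.+1 x)).
Proof.
elim: k f => [|k IH] f fk.
  by exists (fun=> f) => // -[].
have [_ /(_ v)[g [fg /IH[F F0 FP]]]] := fk.
exists (fun j => if j is j'.+1 then F j' else f) => // -[_|j jk].
  by split=> // _ x Dx; rewrite F0; exact: fg.
by rewrite subSS; exact: FP.
Qed.

End regularity.

(** [F j] is the derivative of order [j] of [S] in [q]. The last clause
says that the Taylor coefficients have partial derivatives in the parameter,
continuous at 0. *)
Lemma smooth_part_data (R : realType) (m n : nat) (S : R -> 'rV[R]_m -> R)
    (U : set (R * 'rV[R]_m)) :
  open_nbhs ((0, 0) : R * 'rV[R]_m) U -> Ck_on n.+1 U (fun x => S x.1 x.2) ->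
  exists (F : nat -> R -> 'rV[R]_m -> R) (r : R),
  [/\ F 0%N = S, 0 < r,
     forall j (q : R) (p : 'rV[R]_m), (j <= n)%N -> `|q| < r -> `|p| < r ->
       is_derive q (1 : R) (F j ^~ p) (F j.+1 q p),
     forall j (e : R), (j <= n.+1)%N -> 0 < e -> exists2 s, 0 < s &
       forall (q : R) (p : 'rV[R]_m), `|q| < s -> `|p| < s -> `|F j q p - F j 0 0| < e
   & forall j (i : 'I_m), (j <= n)%N -> exists G : 'rV[R]_m -> R,
      (forall p, `|p| < r -> is_derive p (delta_mx 0 i) (F j 0) (G p)) /\
      (forall e : R, 0 < e -> exists2 s, 0 < s &
         forall p : 'rV[R]_m, `|p| < s -> `|G p - G 0| < e)].
Proof.
move=> [oU U0] SU.
have [F F0 FP] := Ck_on_chain ((1, 0) : R * 'rV[R]_m) SU.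
have nU : \forall x \near ((0, 0) : R * 'rV[R]_m), U x by exact: open_nbhs_nbhs.
have [r r0 rU] := near_pair0 nU.
exists (fun j q p => F j (q, p)), r; split => //.
- by rewrite F0.
- move=> j q p jn qr pr.
  have [_ /(_ jn) Fd] := FP j (leqW jn).
  have /(is_derive_within_open _ _ _ oU (rU _ _ qr pr)) d := Fd _ (rU _ _ qr pr).
  have e : ((q, p) : R * 'rV[R]_m) = q *: (1, 0) + (0, p).
    by congr pair; rewrite /= ?scaler0 ?add0r ?addr0// /GRing.scale /= mulr1.
  have := is_derive_line e d.
  congr (is_derive _ _ _ _); apply/funext => h; congr (F j _).
  by congr pair; rewrite /= ?scaler0 ?add0r ?addr0// /GRing.scale /= mulr1.
- move=> j e jn e0.
  have [Fj _] := FP j jn.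
  have := Ck_on_near Fj U0 e0 => H.
  have : \forall x \near ((0, 0) : R * 'rV[R]_m), `|F j (0, 0) - F j x| < e.
    by apply: filterS2 nU H => x Ux; apply.
  move=> /near_pair0[s s0 sH]; exists s => // q p qs ps.
  by rewrite distrC; exact: sH.
- move=> j i jn.
  have [Fj _] := FP j (leqW jn).
  have [_ /(_ (0, delta_mx 0 i))[G [Gd Gc]]] :
      Ck_on 1 U (F j) by apply: Ck_on_le Fj; rewrite subn_gt0.
  exists (fun p => G (0, p)); split.
    move=> p pr.
    have Up : U (0, p) by apply: rU; rewrite ?normr0.
    have /(is_derive_within_open _ _ _ oU Up) d := Gd _ Up.
    have E : (fun h : R => h^-1 *: (F j (h *: (0, delta_mx 0 i) + (0, p)) - F j (0, p))) =
       (fun h : R => h^-1 *: (F j (0, h *: delta_mx 0 i + p) - F j (0, p))).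
      apply/funext => h; congr (_ *: (F j _ - _)).
      by congr pair; rewrite /= scaler0 addr0.
    apply: DeriveDef.
      by have := @ex_derive _ _ _ _ _ _ _ d; rewrite /derivable /= E.
    by rewrite -(@derive_val _ _ _ _ _ _ _ d) /derive /= E.
  have Gc0 := Ck_on_cont_interior (Gc : Ck_on 0 U G) (nU : nbhs _ U).
  move=> e e0; move/cvgrPdist_lt : Gc0 => /(_ e e0) Gc0.
  have [s s0 sH] := near_pair0 Gc0.
  by exists s => // p ps; rewrite distrC; apply: sH; rewrite ?normr0.
Qed.

Lemma near_triple0 (R : realType) (V : normedModType R) (P : R * R * V -> Prop) :
  (\forall x \near ((0, 0, 0) : R * R * V), P x) ->
  exists2 e : R, 0 < e & forall (s q : R) p,
    `|s| < e -> `|q| < e -> `|p| < e -> P (s, q, p).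
Proof.
move=> /(@near_pair0 _ (R * R)%type V)[e e0 eP]; exists e => // s q p se qe pe.
by apply: eP => //; rewrite /Num.norm /= gt_max se qe.
Qed.

Section curve.
Variables (R : realType) (m nu : nat) (W : set (R * R * 'rV[R]_m)).
Hypothesis oW : open_nbhs ((0, 0, 0) : R * R * 'rV[R]_m) W.
Let D := W `&` [set x | 0 <= x.1.1].
Let curve (s : R) (p : 'rV[R]_m) : R * R * 'rV[R]_m := (s, s ^+ nu, p).

Let interior_D (s q : R) p : 0 < s -> W (s, q, p) -> nbhs ((s, q, p) : R * R * 'rV[R]_m) D.
Proof.
move=> s0 Wx.
have oP : open (W `&` [set x | 0 < x.1.1]).
  apply: openI; first exact: oW.1.
  have := @open_comp _ _ (fun x : R * R * 'rV[R]_m => x.1.1) [set x | 0 < x].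
  apply; last exact: open_gt.
  move=> x _; apply: (@cvg_comp _ _ _ fst fst); [exact: cvg_fst|exact: cvg_fst].
have : nbhs ((s, q, p) : R * R * 'rV[R]_m) (W `&` [set x | 0 < x.1.1]).
  exact: open_nbhs_nbhs.
by apply: filterS => x [Wx' x0]; split => //=; exact: ltW.
Qed.

Let line1 (f : R * R * 'rV[R]_m -> R) (s q : R) p l :
  is_derive ((s, q, p) : R * R * 'rV[R]_m) (1, 0, 0) f l ->
  is_derive s 1 (fun s => f (s, q, p)) l.
Proof.
move=> d.
have e t : ((t, q, p) : R * R * 'rV[R]_m) = t *: (1, 0, 0) + (0, q, p).
  by congr (_, _, _); rewrite /= ?scaler0 ?add0r ?addr0// /GRing.scale /= mulr1.
have := is_derive_line (e s) d.
by congr (is_derive _ _ _ _); apply/funext => h; rewrite (e h).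
Qed.

Let line2 (f : R * R * 'rV[R]_m -> R) (s q : R) p l :
  is_derive ((s, q, p) : R * R * 'rV[R]_m) (0, 1, 0) f l ->
  is_derive q 1 (fun q => f (s, q, p)) l.
Proof.
move=> d.
have e t : ((s, t, p) : R * R * 'rV[R]_m) = t *: (0, 1, 0) + (s, 0, p).
  by congr (_, _, _); rewrite /= ?scaler0 ?add0r ?addr0// /GRing.scale /= mulr1.
have := is_derive_line (e q) d.
by congr (is_derive _ _ _ _); apply/funext => h; rewrite (e h).
Qed.

(** At [s > 0] the one-sided domain is a neighbourhood, so the chain rule
[is_derive_curve] applies. Since the partial derivatives inherit the regularity
of [f], the lemma can be used twice. *)
Lemma Ck_on_curve k (f : R * R * 'rV[R]_m -> R) : Ck_on k.+1 D f -> exists fs fq,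
  [/\ Ck_on k D fs, Ck_on k D fq &
  forall s p, 0 < s -> W (curve s p) ->
    is_derive s 1 (fun s => f (curve s p))
      (fs (curve s p) + fq (curve s p) * (nu%:R * s ^+ nu.-1))].
Proof.
move=> [_ fd].
have [fs [fsd fsk]] := fd (1, 0, 0).
have [fq [fqd fqk]] := fd (0, 1, 0).
exists fs, fq; split => // s p s0 Ws.
pose c (z : R * R) : R * R * 'rV[R]_m := (z, p).
have cc : {for (s, s ^+ nu), continuous c}.
  have h1 : z @[z --> (s, s ^+ nu)] --> (s, s ^+ nu) by exact: cvg_id.
  have h2 : p @[z --> (s, s ^+ nu)] --> p by exact: cvg_cst.
  exact: cvg_pair h1 h2.
have Dn : nbhs (c (s, s ^+ nu)) D by exact: interior_D.
have DD x : nbhs x D -> D x by exact: nbhs_singleton.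
apply: (@is_derive_curve R (fun s q => f (s, q, p)) (fun s q => fs (s, q, p))
  (fun s => s ^+ nu)).
- have Dc : nbhs (s, s ^+ nu) (c @^-1` D^°).
    exact: (cc _ (nbhs_interior Dn)).
  apply: filterS Dc => -[z1 z2] z1z2D.
  have zD : nbhs ((z1, z2, p) : R * R * 'rV[R]_m) D by exact: z1z2D.
  exact: line1 (is_derive_within_interior zD (fsd _ (DD _ zD))).
- have -> : (fun z : R * R => fs (z.1, z.2, p)) = fs \o c by apply/funext => -[].
  have cf := Ck_on_cont_interior (fsk : Ck_on k D fs) Dn.
  exact: continuous_comp cc cf.
- by apply: line2; exact: (is_derive_within_interior Dn (fqd _ (DD _ Dn))).
- exact: is_derive_exprn.
Qed.

Lemma Ck_on_curve_near k (f : R * R * 'rV[R]_m -> R) e : (0 < nu)%N ->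
  Ck_on k D f -> 0 < e -> exists2 r : R, 0 < r & forall s p, 0 <= s < r ->
    `|p| < r -> W (curve s p) /\ `|f (curve s p) - f (0, 0, 0)| < e.
Proof.
move=> nu0 fk e0.
have D0 : D (0, 0, 0) by split; [exact: oW.2|rewrite /= lexx].
have fn := Ck_on_near fk D0 e0.
have Wn : \forall x \near ((0, 0, 0) : R * R * 'rV[R]_m), W x by exact: open_nbhs_nbhs.
have : \forall x \near ((0, 0, 0) : R * R * 'rV[R]_m),
    0 <= x.1.1 -> W x /\ `|f x - f (0, 0, 0)| < e.
  by apply: filterS2 fn Wn => x Hx Wx x0; split=> //; rewrite distrC; exact: Hx.
move=> /near_triple0[r r0 rH]; exists (Num.min r 1); first by rewrite lt_min r0 ltr01.
move=> s p; rewrite !lt_min => /andP[s0 /andP[sr s1]] /andP[pr _].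
apply: rH => //; first by rewrite ger0_norm.
rewrite ger0_norm ?exprn_ge0//; case: (nu) nu0 => // j _.
by rewrite (le_lt_trans _ sr)// exprS ler_piMr// exprn_ile1// ltW.
Qed.

Lemma Ck_on_curve_bounded k (f : R * R * 'rV[R]_m -> R) : (0 < nu)%N ->
  Ck_on k D f -> exists r B : R, [/\ 0 < r, 0 < B &
   forall s p, 0 <= s < r -> `|p| < r -> `|f (curve s p)| <= B].
Proof.
move=> nu0 fk; have [r r0 rH] := Ck_on_curve_near nu0 fk ltr01.
exists r, (`|f (0, 0, 0)| + 1); split => //.
move=> s p sr pr; have [_ /ltW H] := rH s p sr pr.
by rewrite addrC -lerBlDr (le_trans _ H)// lerB_dist.
Qed.

(** Both derivatives of [f] along the curve stay bounded as [s] tends to 0, by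
continuity of the partial derivatives up to the boundary [s = 0]. *)
Lemma curve_derivatives (f : R * R * 'rV[R]_m -> R) : (1 < nu)%N ->
  Ck_on 2 D f -> exists (k1 k2 : R -> 'rV[R]_m -> R) (r B : R),
  [/\ 0 < r, 0 < B & forall s p, 0 < s < r -> `|p| < r ->
    [/\ is_derive s 1 (fun s => f (curve s p)) (k1 s p),
      is_derive s 1 (k1 ^~ p) (k2 s p), `|k1 s p| <= B & `|k2 s p| <= B]].
Proof.
move=> nu1 f2; have nu0 : (0 < nu)%N by exact: ltnW.
have [fs [fq [fs1 fq1 fd]]] := Ck_on_curve f2.
have [fss [fsq [fss0 fsq0 fsd]]] := Ck_on_curve fs1.
have [fqs [fqq [fqs0 fqq0 fqd]]] := Ck_on_curve fq1.
have [r1 r10 r1H] := Ck_on_curve_near nu0 fs1 ltr01.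
have [r2 [B2 [r20 B20 H2]]] := Ck_on_curve_bounded nu0 fs1.
have [r3 [B3 [r30 B30 H3]]] := Ck_on_curve_bounded nu0 fq1.
have [r4 [B4 [r40 B40 H4]]] := Ck_on_curve_bounded nu0 fss0.
have [r5 [B5 [r50 B50 H5]]] := Ck_on_curve_bounded nu0 fsq0.
have [r6 [B6 [r60 B60 H6]]] := Ck_on_curve_bounded nu0 fqs0.
have [r7 [B7 [r70 B70 H7]]] := Ck_on_curve_bounded nu0 fqq0.
pose w (s : R) := nu%:R * s ^+ nu.-1.
pose w' (s : R) := nu%:R * (nu.-1%:R * s ^+ nu.-2).
pose k1 s p := fs (curve s p) + fq (curve s p) * w s.
pose k2 s p := (fss (curve s p) + fsq (curve s p) * w s) +
  (fq (curve s p) * w' s + w s * (fqs (curve s p) + fqq (curve s p) * w s)).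
pose r := Num.min 1 (Num.min r1 (Num.min r2 (Num.min r3 (Num.min r4
   (Num.min r5 (Num.min r6 r7)))))).
pose N : R := nu%:R ^+ 2 : R.
pose B := (B2 + B3 * N) + (B4 + B5 * N + (B3 * N + N * (B6 + B7 * N))).
have N0 : 0 < N by rewrite exprn_gt0// ltr0n.
have pos3 : 0 < B3 * N by exact: mulr_gt0.
have pos5 : 0 < B5 * N by exact: mulr_gt0.
have pos67 : 0 < N * (B6 + B7 * N).
  by apply: mulr_gt0 => //; apply: addr_gt0 => //; exact: mulr_gt0.
exists k1, k2, r, B; split.
- by rewrite /r !lt_min ltr01 r10 r20 r30 r40 r50 r60 r70.
- by rewrite /B; lra.
move=> s p /andP[s0]; rewrite /r !lt_min.
move=> /and5P[s1 sr1 sr2 sr3 /and4P[sr4 sr5 sr6 sr7]].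
move=> /and5P[_ pr1 pr2 pr3 /and4P[pr4 pr5 pr6 pr7]].
have Ws : W (curve s p) by apply: (r1H s p _ pr1).1; rewrite sr1 ltW.
have nuN : nu%:R <= N :> R by rewrite /N expr2 ler_peMr// ler1n.
have wN : `|w s| <= N.
  rewrite /w normrM normr_nat (le_trans _ nuN)// ler_piMr//.
  by rewrite normrX exprn_ile1// ger0_norm ltW.
have w'N : `|w' s| <= N.
  rewrite /w' !normrM !normr_nat /N expr2 ler_wpM2l//.
  apply: (@le_trans _ _ nu.-1%:R); last by rewrite ler_nat leq_pred.
  by rewrite ler_piMr// normrX exprn_ile1// ger0_norm ltW.
have s0r r' : s < r' -> 0 <= s < r' by move=> ->; rewrite ltW.
have le2 (x y X Y : R) : `|x| <= X -> `|y| <= Y -> `|x + y| <= X + Y.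
  by move=> xX yY; rewrite (le_trans (ler_normD _ _))// lerD.
have leM (x y X Y : R) : `|x| <= X -> `|y| <= Y -> `|x * y| <= X * Y.
  by move=> xX yY; rewrite normrM ler_pM.
have H2' := H2 s p (s0r _ sr2) pr2.
have H3' := H3 s p (s0r _ sr3) pr3.
have H4' := H4 s p (s0r _ sr4) pr4.
have H5' := H5 s p (s0r _ sr5) pr5.
have H6' := H6 s p (s0r _ sr6) pr6.
have H7' := H7 s p (s0r _ sr7) pr7.
split.
- exact: fd.
- apply: (@is_deriveD _ _ _ (fun s => fs (curve s p))); first exact: fsd.
  have -> : fq (curve s p) * w' s + w s * (fqs (curve s p) + fqq (curve s p) * w s)
     = fq (curve s p) *: w' s + w s *: (fqs (curve s p) + fqq (curve s p) * w s) by [].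
  apply: (@is_deriveM _ _ (fun s => fq (curve s p))); first exact: fqd.
  have := @is_deriveZ _ _ _ _ nu%:R s 1 _ (is_derive_exprn nu.-1 s).
  by [].
- rewrite (@le_trans _ _ (B2 + B3 * N))//; first by apply: (le2) => //; exact: (leM).
  by rewrite /B; lra.
- apply: (@le_trans _ _ (B4 + B5 * N + (B3 * N + N * (B6 + B7 * N)))).
    apply: (le2); first by apply: (le2) => //; exact: (leM).
    apply: (le2); first exact: (leM).
    by apply: (leM) => //; apply: (le2) => //; exact: (leM).
  by rewrite /B; lra.
Qed.

End curve.

(** * The displacement across the seam *)

Section root.
Variables (R : realType) (nu : nat).
Hypothesis nu0 : (0 < nu)%N.
(** The coordinate [s] with [q = s ^ nu] on the positive side, extended by 0. *)
Definition seam_root (q : R) := posp q `^ nu%:R^-1.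

Let nuR : (nu%:R : R) != 0. Proof. by rewrite pnatr_eq0 -lt0n. Qed.
Let nuV : 0 < (nu%:R^-1 : R). Proof. by rewrite invr_gt0 ltr0n. Qed.

Lemma seam_root_ge0 q : 0 <= seam_root q. Proof. exact: powR_ge0. Qed.

Lemma posp_ge0 (q : R) : 0 <= posp q. Proof. by rewrite /posp le_max lexx orbT. Qed.

Lemma posp_id (q : R) : 0 <= q -> posp q = q.
Proof. by move=> q0; apply/max_idPl. Qed.

Lemma posp_0 (q : R) : q <= 0 -> posp q = 0.
Proof. by move=> q0; apply/max_idPr. Qed.

Lemma seam_rootXn q : seam_root q ^+ nu = posp q.
Proof.
by rewrite -powR_mulrn ?seam_root_ge0// /seam_root -powRrM mulVf// powRr1// posp_ge0.
Qed.

Lemma powR_posp q : posp q `^ (1 + nu%:R^-1) = seam_root q ^+ nu.+1.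
Proof.
rewrite powRD; last by apply/implyP; rewrite gt_eqF// ltr_pwDl.
by rewrite powRr1 ?posp_ge0// exprS seam_rootXn mulrC.
Qed.

Lemma seam_root_le0 q : q <= 0 -> seam_root q = 0.
Proof. by move=> q0; rewrite /seam_root posp_0// powR0// gt_eqF. Qed.

Lemma seam_root_exp s : 0 <= s -> seam_root (s ^+ nu) = s.
Proof.
move=> s0; rewrite /seam_root posp_id ?exprn_ge0// -powR_mulrn// -powRrM mulfV//.
by rewrite powRr1.
Qed.

Lemma seam_root_gt0 q : 0 < q -> 0 < seam_root q.
Proof. by move=> q0; rewrite powR_gt0// posp_id ?ltW. Qed.

Lemma seam_root_lt x y : 0 <= x -> x < y -> seam_root x < seam_root y.
Proof.
move=> x0 xy; have y0 : 0 <= y by rewrite (le_trans x0)// ltW.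
by rewrite -(ltr_pXn2r nu0) ?nnegrE ?seam_root_ge0// !seam_rootXn !posp_id.
Qed.

Lemma seam_root_lt_exp q s : 0 < s -> q < s ^+ nu -> seam_root q < s.
Proof.
move=> s0 qs; rewrite -(ltr_pXn2r nu0) ?nnegrE ?seam_root_ge0 ?ltW// seam_rootXn.
by rewrite /posp gt_max qs exprn_gt0.
Qed.

End root.

(** Sums up the error terms in [slope_sign], where [a] is [nu] and [D] is [`|d|]. *)
Lemma slope_arith (R : realFieldType) (a D M s : R) :
  0 <= a -> 0 < D -> 0 < M * s -> M * s * (a ^+ 2 + a + 4) < D / 2 ->
  a ^+ 2 * (s * M) + (a + 1) * (D / 4) + (a + 1) * (s * M) + s * M + 2 * (s * M)
    < (a + 1) * D.
Proof.
move=> a0 D0 Ms0; have := mulr_ge0 a0 (ltW D0); lra.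
Qed.

(** The analogue of [slope_arith] for the increments from the seam. *)
Lemma slope_arith0 (R : realFieldType) (a D M s : R) :
  0 <= a -> 0 < D -> 0 < M * s -> M * s * (a ^+ 2 + a + 4) < D / 2 ->
  a * (s * M) + (a + 1) * (D / 4) + s * M < (a + 1) * D.
Proof.
move=> a0 D0 Ms0; have := mulr_ge0 a0 (ltW D0).
have := mulr_ge0 (ltW Ms0) (sqr_ge0 a); lra.
Qed.

Section ramified.
Variables (R : realType) (nu : nat).
Hypothesis nu1 : (1 < nu)%N.
Variables (S0 S1 S2 k k1 k2 Delta : R -> R) (d M rho sigma : R).
Hypothesis sigma0 : 0 < sigma <= 1.
Hypothesis rho0 : 0 < rho <= sigma ^+ nu.
Hypothesis M0 : 0 < M.
Hypothesis Msigma : M * sigma * (nu%:R ^+ 2 + nu%:R + 4) < `|d| / 2.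
Hypothesis S0d : forall q : R, `|q| < rho -> is_derive q 1 S0 (S1 q).
Hypothesis S1d : forall q : R, `|q| < rho -> is_derive q 1 S1 (S2 q).
Hypothesis S2M : forall q : R, `|q| < rho -> `|S2 q| <= M.
Hypothesis kd : forall s : R, 0 < s < sigma -> is_derive s 1 k (k1 s).
Hypothesis k1d : forall s : R, 0 < s < sigma -> is_derive s 1 k1 (k2 s).
Hypothesis k1M : forall s : R, 0 < s < sigma -> `|k1 s| <= M.
Hypothesis k2M : forall s : R, 0 < s < sigma -> `|k2 s| <= M.
Hypothesis kclose : forall s : R, 0 <= s < sigma -> `|k s - d| <= `|d| / 4.
Hypothesis DeltaE : forall q : R, `|q| < rho ->
  Delta q = S0 q + seam_root nu q ^+ nu.+1 * k (seam_root nu q).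

(** The derivative in [q] of the ramified term, written in the coordinate [s]:
[(s ^ (nu + 1) * k s)' / (nu * s ^ (nu - 1))]. *)
Definition ramified_slope (s : R) := (nu.+1%:R * (s * k s) + s ^+ 2 * k1 s) / nu%:R.
Definition displacement_slope (q : R) := S1 q + ramified_slope (seam_root nu q).

Let nu0 : (0 < nu)%N. Proof. exact: ltnW. Qed.
Let nuR : 0 < (nu%:R : R). Proof. by rewrite ltr0n. Qed.

Lemma displacement_slope_le0 q : q <= 0 -> displacement_slope q = S1 q.
Proof.
move=> q0; rewrite /displacement_slope /ramified_slope seam_root_le0//.
by rewrite mul0r mulr0 expr0n mul0r add0r mul0r addr0.
Qed.

Let near_rho (q : R) : `|q| < rho -> \forall x \near q, `|x| < rho.
Proof.
move=> qr; apply/nbhs_ballP; exists (rho - `|q|); first by rewrite /= subr_gt0.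
move=> x; rewrite /ball /= distrC ltrBrDr; apply: le_lt_trans.
by rewrite -{1}(subrK q x) ler_normD.
Qed.

Let psi_derive (s : R) : 0 < s < sigma ->
  is_derive s 1 (fun s => s ^+ nu.+1 * k s) (nu%:R * s ^+ nu.-1 * ramified_slope s).
Proof.
move=> s0.
have := is_deriveM (is_derive_exprn nu.+1 s) (kd s0).
congr (is_derive _ _ _ _); rewrite /ramified_slope /GRing.scale /= -{2}(prednK nu0) exprS.
by case: (nu) nuR => [|j]; rewrite ?ltxx//= => j0; rewrite !exprS; field; rewrite gt_eqF.
Qed.

(** For [q > 0] this is the chain rule for [s = q ^ (1 / nu)]. At the seam the
ramified term is [s * (q * k s)], which is negligible with respect to [q]. *)
Lemma is_derive_displacement (q : R) : `|q| < rho -> is_derive q 1 Delta (displacement_slope q).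
Proof.
move=> qr; have [q0|q0|q0] := ltgtP q 0.
- rewrite displacement_slope_le0 ?ltW//; apply: near_eq_is_derive (S0d qr).
  near=> x; rewrite DeltaE; last by near: x; exact: near_rho.
  rewrite seam_root_le0// ?expr0n ?mul0r ?addr0//.
  by near: x; exact: lt_le_nbhsl.
- have E : \forall x \near q, S0 x + (fun s => s ^+ nu.+1 * k s) (x `^ nu%:R^-1) = Delta x.
    near=> x; have x0 : 0 < x by near: x; exact: lt_nbhsr.
    by rewrite DeltaE; [rewrite /seam_root posp_id ?ltW|near: x; exact: near_rho].
  apply: near_eq_is_derive E _.
  apply: (@is_deriveD _ _ _ S0); first exact: S0d.
  have rq : 0 < seam_root nu q < sigma.
    rewrite seam_root_gt0//= seam_root_lt_exp//; case/andP: sigma0 => // _ _.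
    by case/andP: rho0 => _; apply: lt_le_trans; rewrite (le_lt_trans (ler_norm _)).
  have e : q `^ nu%:R^-1 = seam_root nu q by rewrite /seam_root posp_id ?ltW.
  have d1 := is_derive1_powR nu%:R^-1 q0.
  have d2 := psi_derive rq; rewrite -e in d2.
  have := @is_derive1_comp R _ (fun x => x `^ nu%:R^-1) q _ _ d2 d1.
  congr (is_derive _ _ _ _); rewrite e.
  have -> : q `^ (nu%:R^-1 - 1) = seam_root nu q / q.
    rewrite powRB; last by apply/implyP => _; rewrite gt_eqF.
    by rewrite e powRr1// ltW.
  have qE : q = seam_root nu q * seam_root nu q ^+ nu.-1.
    by rewrite -exprS prednK// seam_rootXn// posp_id ?ltW.
  have r0 : seam_root nu q != 0 by rewrite gt_eqF// seam_root_gt0.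
  have r'0 : seam_root nu q ^+ nu.-1 != 0 by rewrite expf_neq0.
  have H (x y c : R) : x != 0 -> y != 0 ->
      nu%:R * y * c * (nu%:R^-1 * (x / (x * y))) = c.
    by move=> x0 y0; field; rewrite x0 y0 gt_eqF.
  by rewrite -[RHS](H _ _ _ r0 r'0) -qE.
- rewrite q0 displacement_slope_le0//; apply: is_derive_eps => e e0.
  have S00 : is_derive (0 : R) 1 S0 (S1 0) by apply: S0d; rewrite -q0.
  have e20 : 0 < e / 2 by rewrite divr_gt0.
  have H := is_derive_eps_inv S00 e20.
  have dd : 0 < 2 * `|d| + 1 by rewrite ltr_wpDl// mulr_ge0.
  (* For [s < z], [s * `|k s| <= e / 2], since [`|k|] is at most [2 * `|d| + 1]. *)
  pose z := Num.min (e / 2 / (2 * `|d| + 1)) sigma.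
  have z0 : 0 < z by rewrite lt_min divr_gt0//; case/andP: sigma0 => ->.
  have zn : 0 < z ^+ nu by rewrite exprn_gt0.
  have Hz := near0_norm_lt R^o zn.
  have Hr : \forall h \near (0 : R), `|h| < rho by apply: near_rho; rewrite -q0.
  near=> h.
  rewrite addr0.
  have hr : `|h| < rho by near: h.
  have hz : `|h| < z ^+ nu by near: h.
  have hH : `|S0 (h + 0) - S0 0 - S1 0 * h| <= e / 2 * `|h| by near: h.
  rewrite addr0 in hH.
  rewrite !DeltaE ?normr0//; [|by case/andP: rho0].
  rewrite (seam_root_le0 nu0 (lexx 0)) expr0n mul0r addr0.
  have -> : S0 h + seam_root nu h ^+ nu.+1 * k (seam_root nu h) - S0 0 - S1 0 * h =
    (S0 h - S0 0 - S1 0 * h) + seam_root nu h * (seam_root nu h ^+ nu * k (seam_root nu h)).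
    by rewrite exprS; ring.
  rewrite (le_trans (ler_normD _ _))//.
  rewrite [leRHS](_ : _ = e / 2 * `|h| + e / 2 * `|h|); last by field.
  rewrite lerD// !normrM (ger0_norm (seam_root_ge0 _ _)) seam_rootXn//.
  have rz : seam_root nu h < z by apply: seam_root_lt_exp => //; rewrite (le_lt_trans (ler_norm _)).
  have ph : `|posp h| <= `|h|.
    rewrite ger0_norm ?posp_ge0// /posp ge_max normr_ge0 andbT; exact: ler_norm.
  have kb : `|k (seam_root nu h)| <= 2 * `|d| + 1.
    have : `|k (seam_root nu h) - d| <= `|d| / 4.
      by apply: kclose; rewrite seam_root_ge0 (lt_le_trans rz)// ge_min lexx orbT.
    have := ler_normD (k (seam_root nu h) - d) d; rewrite subrK.
    have := normr_ge0 d; lra.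
  have zd : z * (2 * `|d| + 1) <= e / 2.
    by rewrite -ler_pdivlMr// ge_min lexx.
  have := ler_pM (seam_root_ge0 nu h)
    (mulr_ge0 (normr_ge0 (posp h)) (normr_ge0 (k (seam_root nu h))))
    (ltW rz) (ler_pM (normr_ge0 _) (normr_ge0 _) ph kb).
  move=> /le_trans; apply.
  rewrite (_ : z * (`|h| * (2 * `|d| + 1)) = z * (2 * `|d| + 1) * `|h|); last by ring.
  by rewrite ler_wpM2r.
Unshelve. all: by end_near. Qed.

Let slope (s : R) := nu%:R * s ^+ nu.-1 * S2 (s ^+ nu) +
  (nu.+1%:R * (s * k1 s + k s) + (s ^+ 2 * k2 s + k1 s * (2 * s))) / nu%:R.

Let slope_derive (s : R) : 0 < s < sigma -> `|s ^+ nu| < rho ->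
  is_derive s 1 (fun s => S1 (s ^+ nu) + ramified_slope s) (slope s).
Proof.
move=> ss sr.
have D0 : is_derive s 1 (fun s => S1 (s ^+ nu)) (nu%:R * s ^+ nu.-1 * S2 (s ^+ nu)).
  have := @is_derive1_comp R S1 (fun s => s ^+ nu) s _ _ (S1d sr) (is_derive_exprn nu s).
  by rewrite mulrC.
have D1 : is_derive s 1 (fun s => s * k s) (s * k1 s + k s).
  have := is_deriveM (is_derive_id s (1 : R)) (kd ss).
  by rewrite /GRing.scale /= mulr1.
have D2 : is_derive s 1 (fun s => s ^+ 2 * k1 s) (s ^+ 2 * k2 s + k1 s * (2 * s)).
  by have := is_deriveM (is_derive_exprn 2 s) (k1d ss); rewrite /GRing.scale /= expr1.
have D3 := is_deriveZ nu.+1%:R D1.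
have := is_deriveD D0 (is_deriveZ nu%:R^-1 (is_deriveD D3 D2)).
congr (is_derive _ _ _ _); last by rewrite /slope /GRing.scale /= [_^-1 * _]mulrC.
by apply/funext => x; rewrite /ramified_slope [RHS]addrC mulrC addrC.
Qed.

Let same_sign (a x : R) : 0 < a -> `|x - a * d| < a * `|d| -> 0 < d * x.
Proof.
move=> a0; rewrite ltr_norml => /andP[xl xr].
have [d0|d0|d0] := ltgtP d 0.
- rewrite nmulr_rgt0//; move: xr; rewrite (ltr0_norm d0); lra.
- rewrite pmulr_rgt0//; move: xl; rewrite (gtr0_norm d0); lra.
- by move: (lt_trans xl xr); rewrite d0 normr0 mulr0 oppr0 ltxx.
Qed.

Let Msigma0 : 0 < M * sigma.
Proof. by rewrite mulr_gt0//; case/andP: sigma0. Qed.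

Let d0 : 0 < `|d|.
Proof.
suff : 0 < `|d| / 2 by rewrite pmulr_lgt0.
apply: le_lt_trans Msigma; apply: mulr_ge0; first exact: ltW.
by rewrite !addr_ge0// exprn_ge0.
Qed.

Let nuge2 : 2 <= (nu%:R : R). Proof. by rewrite (ler_nat _ 2). Qed.

Let nuS : (nu.+1%:R : R) = nu%:R + 1. Proof. by rewrite -natr1. Qed.

Let hN (a x X : R) : 0 <= a -> `|x| <= X -> `|a * x| <= a * X.
Proof. by move=> a0 xX; rewrite normrM ger0_norm// ler_wpM2l. Qed.

Let exp_le (s : R) : 0 < s < sigma -> s ^+ nu.-1 <= sigma.
Proof.
move=> /andP[s0 ss]; have s1 : s <= 1 by case/andP: sigma0 => _; apply: le_trans; exact: ltW.
apply: le_trans (ltW ss); case: (nu) nu1 => [|[|j]]//= _.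
by rewrite exprS ler_piMr ?exprn_ile1// ltW.
Qed.

Let slope_sign (s : R) : 0 < s < sigma -> `|s ^+ nu| < rho -> 0 < d * slope s.
Proof.
move=> ss sr; have := ss => /andP[s0 s's].
suff : 0 < d * (nu%:R * slope s) by rewrite mulrCA pmulr_rgt0.
apply: (@same_sign nu.+1%:R); first by rewrite ltr0n.
have -> : nu%:R * slope s - nu.+1%:R * d =
   nu%:R ^+ 2 * (s ^+ nu.-1 * S2 (s ^+ nu)) + nu.+1%:R * (k s - d) +
   nu.+1%:R * (s * k1 s) + s ^+ 2 * k2 s + 2 * (s * k1 s).
  by rewrite /slope; field; rewrite gt_eqF.
have s1 : s <= 1 by case/andP: sigma0 => _; apply: le_trans; exact: ltW.
have b1 : `|s ^+ nu.-1 * S2 (s ^+ nu)| <= sigma * M.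
  rewrite normrM ler_pM ?S2M// ger0_norm; first exact: exp_le.
  exact/exprn_ge0/ltW.
have b2 : `|s * k1 s| <= sigma * M.
  by rewrite normrM ler_pM ?k1M// ger0_norm ltW.
have b3 : `|s ^+ 2 * k2 s| <= sigma * M.
  rewrite normrM ler_pM ?k2M// ger0_norm; last exact/exprn_ge0/ltW.
  by rewrite expr2 (le_trans _ (ltW s's))// ler_piMr// ltW.
have b4 : `|k s - d| <= `|d| / 4 by apply: kclose; rewrite s's ltW.
have B : `|nu%:R ^+ 2 * (s ^+ nu.-1 * S2 (s ^+ nu)) + nu.+1%:R * (k s - d) +
   nu.+1%:R * (s * k1 s) + s ^+ 2 * k2 s + 2 * (s * k1 s)| <=
   nu%:R ^+ 2 * (sigma * M) + nu.+1%:R * (`|d| / 4) + nu.+1%:R * (sigma * M) +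
   sigma * M + 2 * (sigma * M).
  do 4 (apply: (le_trans (ler_normD _ _)); apply: lerD; last by [exact: b3|exact: hN]).
  by apply: hN => //; exact: exprn_ge0.
apply: (le_lt_trans B); rewrite nuS.
by apply: slope_arith => //; exact: ltW.
Qed.

Let G (s : R) := S1 (s ^+ nu) + ramified_slope s.

Let in_rho (s : R) : 0 <= s -> s ^+ nu < rho -> `|s ^+ nu| < rho.
Proof. by move=> s0 sr; rewrite ger0_norm ?exprn_ge0. Qed.

Let G_incr (s1 s2 : R) : 0 < s1 -> s1 < s2 -> s2 < sigma -> s2 ^+ nu < rho ->
  0 < d * (G s2 - G s1).
Proof.
move=> s10 s12 s2s s2r.
have s2n (s : R) : s1 <= s <= s2 -> 0 < s < sigma /\ `|s ^+ nu| < rho.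
  move=> /andP[s1s ss2]; have s0 : 0 < s by exact: lt_le_trans s1s.
  rewrite s0 (le_lt_trans ss2)//; split => //; apply: in_rho; first exact: ltW.
  apply: le_lt_trans s2r; apply: lerXn2r => //; rewrite nnegrE ltW//.
  exact: lt_trans s12.
have [x /andP[s1x xs2] ->] : exists2 x, s1 < x < s2 & G s2 - G s1 = slope x * (s2 - s1).
  by apply: MVT_interior => // x /s2n[? ?]; exact: slope_derive.
rewrite mulrA mulr_gt0 ?subr_gt0//.
by have [|xs xr] := s2n x; [rewrite !ltW|exact: slope_sign].
Qed.

Let G_incr0 (s : R) : 0 < s -> s < sigma -> s ^+ nu < rho -> 0 < d * (G s - G 0).
Proof.
move=> s0 ss sr; suff : 0 < d * (nu%:R * (G s - G 0)) by rewrite mulrCA pmulr_rgt0.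
have sx0 : 0 < s ^+ nu by rewrite exprn_gt0.
apply: (@same_sign (nu.+1%:R * s)); first by rewrite mulr_gt0.
have [x /andP[x0 xs] Ex] : exists2 x, 0 < x < s ^+ nu &
    S1 (s ^+ nu) - S1 0 = S2 x * (s ^+ nu - 0).
  apply: MVT_interior => // x /andP[x0 xs]; apply: S1d.
  by rewrite ger0_norm// (le_lt_trans xs).
have G0 : G 0 = S1 0.
  by rewrite /G /ramified_slope !expr0n !mul0r mulr0 addr0 mul0r addr0 gtn_eqF.
have E : nu%:R * (G s - G 0) - nu.+1%:R * s * d =
   s * (nu%:R * (s ^+ nu.-1 * S2 x) + nu.+1%:R * (k s - d) + s * k1 s).
  have es : s ^+ nu = s * s ^+ nu.-1 by rewrite -exprS prednK.
  by rewrite G0 /G addrAC Ex subr0 /ramified_slope es; field; rewrite gt_eqF.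
rewrite E normrM (gtr0_norm s0) -mulrA [X in _ < X]mulrCA ltr_pM2l//.
have xr : `|x| < rho by rewrite gtr0_norm// (lt_trans xs).
have b1 : `|s ^+ nu.-1 * S2 x| <= sigma * M.
  rewrite normrM ler_pM ?S2M// ger0_norm; first by apply: exp_le; rewrite s0.
  exact/exprn_ge0/ltW.
have b2 : `|s * k1 s| <= sigma * M.
  by rewrite normrM ler_pM ?k1M ?s0// ger0_norm ltW.
have b4 : `|k s - d| <= `|d| / 4 by apply: kclose; rewrite ss ltW.
have B : `|nu%:R * (s ^+ nu.-1 * S2 x) + nu.+1%:R * (k s - d) + s * k1 s| <=
   nu%:R * (sigma * M) + nu.+1%:R * (`|d| / 4) + sigma * M.
  do 2 (apply: (le_trans (ler_normD _ _)); apply: lerD; last by [exact: b2|exact: hN]).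
  exact: hN.
apply: (le_lt_trans B); rewrite nuS.
by apply: slope_arith0 => //; exact: ltW.
Qed.

(** In the coordinate [s] the derivative of the slope is
[((nu + 1) * d + o(1)) / nu], so its sign is that of [d]. The increments from
the seam itself are treated apart, because [k1] is controlled for [s > 0]
only. *)
Lemma displacement_slope_increasing (x y : R) : 0 <= x -> x < y -> y < rho ->
  0 < d * (displacement_slope y - displacement_slope x).
Proof.
move=> x0 xy yr; have y0 : 0 < y by exact: le_lt_trans xy.
have dG (z : R) : 0 <= z -> displacement_slope z = G (seam_root nu z).
  by move=> z0; rewrite /displacement_slope /G seam_rootXn// posp_id.
have ys : seam_root nu y < sigma.
  by apply: seam_root_lt_exp => //; [case/andP: sigma0|rewrite (lt_le_trans yr)//; case/andP: rho0].
have yr' : seam_root nu y ^+ nu < rho by rewrite seam_rootXn// posp_id// ltW.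
rewrite !dG ?(ltW y0)//.
move: x0; rewrite le_eqVlt => /orP[/eqP<-|x0].
  by rewrite (seam_root_le0 nu0 (lexx 0)); apply: G_incr0 => //; exact: seam_root_gt0.
by apply: G_incr => //; [exact: seam_root_gt0|apply: seam_root_lt => //; exact: ltW].
Qed.

End ramified.

(** * Local sections of submersions *)

(** Row vectors form a complete normed module, as the contraction principle
requires. *)
HB.instance Definition _ (R : realType) (n : nat) :=
  Uniform_isComplete.Build 'rV[R]_n (@cauchy_cvg 'rV[R]_n).

Lemma row_norm_leP (R : realType) (m : nat) (p : 'rV[R]_m) (s : R) : 0 <= s ->
  reflect (forall i, `|p 0 i| <= s) (`|p| <= s).
Proof.
move=> s0; rewrite /Num.norm /= mx_normrE.
apply: (iffP (bigmax_leP _ _ _ _)) => [[_ H] i|H]; first exact: (H (0, i)).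
by split=> // -[i j] _ /=; rewrite ord1; exact: H.
Qed.

Lemma row_norm_ltP (R : realType) (m : nat) (p : 'rV[R]_m) (s : R) : 0 < s ->
  reflect (forall i, `|p 0 i| < s) (`|p| < s).
Proof.
move=> s0; rewrite /Num.norm /= mx_normrE.
apply: (iffP (bigmax_ltP _ _ _ _)) => [[_ H] i|H]; first exact: (H (0, i)).
by split=> // -[i j] _ /=; rewrite ord1; exact: H.
Qed.

Lemma row_coord_le (R : realType) (m : nat) (p : 'rV[R]_m) i : `|p 0 i| <= `|p|.
Proof. exact/row_norm_leP. Qed.

(** The segment from [y] to [x] is replaced by a path parallel to the coordinate
axes, on each edge of which the mean value theorem applies. *)
Lemma strict_differentiability (R : realType) (m : nat) (f : 'rV[R]_m -> R)
    (G : 'I_m -> 'rV[R]_m -> R) (r : R) : 0 < r ->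
  (forall i p, `|p| < r -> is_derive p (delta_mx 0 i) f (G i p)) ->
  (forall i e, 0 < e -> exists2 s, 0 < s &
      forall p, `|p| < s -> `|G i p - G i 0| < e) ->
  forall e, 0 < e -> exists2 s, 0 < s & forall x y, `|x| < s -> `|y| < s ->
    `|f x - f y - \sum_i (x 0 i - y 0 i) * G i 0| <= e * `|x - y|.
Proof.
move=> r0 fG Gc e e0.
pose e' := e / m.+1%:R.
have e'0 : 0 < e' by rewrite divr_gt0.
have : \forall p \near (0 : 'rV[R]_m), (`|p| < r) /\ forall i, `|G i p - G i 0| < e'.
  have nr : \forall p \near (0 : 'rV[R]_m), `|p| < r by exact: near0_norm_lt.
  have nG : \forall p \near (0 : 'rV[R]_m), forall i, `|G i p - G i 0| < e'.
    apply: (@filter_forall _ _ (fun i => [set p | `|G i p - G i 0| < e']) _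
       (nbhs_filter (0 : 'rV[R]_m))) => i.
    have [s s0 sH] := Gc i e' e'0.
    by apply/(@nbhs_norm0P R 'rV[R]_m); exists s.
  by apply: filterS2 nr nG.
move=> /nbhs_norm0P[s /= s0 sH]; exists s => // x y xs ys.
(* The vertices of the path: the first [k] coordinates are already those of [x]. *)
pose z k : 'rV[R]_m := \row_i (if (i < k)%N then x 0 i else y 0 i).
have -> : f x - f y = \sum_(i < m) (f (z i.+1) - f (z i)).
  rewrite -(big_mkord xpredT (fun i => f (z i.+1) - f (z i))) telescope_sumr//.
  congr (f _ - f _); apply/rowP => i; rewrite mxE ?ltn_ord//.
rewrite -sumrB (le_trans (ler_norm_sum _ _ _))//.
apply: (@le_trans _ _ (\sum_(i < m) e' * `|x - y|)); last first.
  rewrite sumr_const card_ord -mulr_natl mulrA ler_wpM2r// /e' mulrCA ger_pMr//.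
  by rewrite ler_pdivrMr// mul1r ler_nat.
apply: ler_sum => i _.
pose g h := h *: (delta_mx 0 i : 'rV[R]_m) + z i.
have zg : z i.+1 = g (x 0 i - y 0 i).
  apply/rowP => j; rewrite !mxE /= ltnS leq_eqVlt.
  have [->|ji] := eqVneq j i.
    by rewrite eqxx ltnn /= mulr1 subrK.
  by rewrite (_ : (_ == _ :> nat) = false) ?mulr0 ?add0r//; apply/negbTE.
have z0 : z i = g 0 by rewrite /g scale0r add0r.
have gs h : Num.min 0 (x 0 i - y 0 i) <= h <= Num.max 0 (x 0 i - y 0 i) -> `|g h| < s.
  move=> hb; apply/row_norm_ltP => // j; rewrite !mxE /=.
  have xj : `|x 0 j| < s by exact/row_norm_ltP.
  have yj : `|y 0 j| < s by exact/row_norm_ltP.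
  have [ji|ji] := eqVneq j i; last by rewrite mulr0 add0r; case: ifP.
  rewrite ji ltnn mulr1 -ji; apply: (between_norm_lt yj xj).
  move: hb; rewrite -ji => /andP[h1 h2].
  move: h1 h2; rewrite ge_min le_max => h1 h2.
  rewrite ge_min le_max; apply/andP; split.
    case/orP: h1 => h1; first by rewrite lerDr h1.
    by rewrite -[x 0 j <= _]lerBlDr h1 orbT.
  case/orP: h2 => h2; first by rewrite gerDr h2.
  by rewrite -[_ <= x 0 j]lerBrDr h2 orbT.
have [h hb E] : exists2 h, Num.min 0 (x 0 i - y 0 i) <= h <= Num.max 0 (x 0 i - y 0 i) &
    f (g (x 0 i - y 0 i)) - f (g 0) = G i (g h) * (x 0 i - y 0 i - 0).
  apply: (@MVT_between R (f \o g) (fun h => G i (g h))) => h /gs gh.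
  apply: is_derive_line; first by [].
  by apply: fG; have [] := sH (g h) gh.
rewrite zg z0 E subr0 [G i _ * _]mulrC -mulrBr normrM mulrC ler_pM//.
  by apply: ltW; have [_] := sH (g h) (gs h hb); exact.
by have := row_coord_le (x - y) i; rewrite !mxE.
Qed.

(** For small [a], the map [x |-> x - Phi x + a] is a contraction of a closed ball,
and its fixed points are the solutions of [Phi x = a]. *)
Lemma near_identity_inverse (R : realType) (n : nat) (Phi : 'rV[R]_n -> 'rV[R]_n)
    (r : R) : 0 < r -> Phi 0 = 0 ->
  (forall x y, `|x| <= r -> `|y| <= r ->
     `|Phi x - Phi y - (x - y)| <= 2^-1 * `|x - y|) ->
  exists psi, (forall a, `|a| <= r / 2 -> Phi (psi a) = a) /\
    (forall a b, `|a| <= r / 2 -> `|b| <= r / 2 ->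
       `|psi a - psi b| <= 2 * `|a - b|) /\ psi 0 = 0.
Proof.
move=> r0 Phi0 PhiH.
have ex a : exists x, `|a| <= r / 2 -> `|x| <= r /\ Phi x = a.
  have [ar|] := boolP (`|a| <= r / 2); last by exists 0.
  pose T x := x - Phi x + a.
  pose U := [set x : 'rV[R]_n | `|x| <= r].
  have TU : {homo T : x / U x >-> U x}.
    move=> x xr; have := PhiH x 0 xr; rewrite normr0 ltW// => /(_ isT).
    rewrite Phi0 !subr0 distrC => H.
    rewrite /U /= /T (le_trans (ler_normD _ _))//.
    rewrite [leRHS](_ : _ = 2^-1 * r + r / 2); last by field.
    rewrite lerD// (le_trans H)// ler_wpM2l//.
  have [|||x xr xT] := @banach_fixed_point R 'rV[R]_n U (mkfun_fun TU).
  - exists (2^-1)%:nng; split => /=; first by rewrite invf_lt1// ltr1n.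
    move=> -[x y] [/= xr yr]; rewrite -normrN; have := PhiH x y xr yr.
    congr (`|_| <= _); rewrite /T; apply/rowP => i; rewrite !mxE.
    by rewrite /mkfun; ring.
  - have -> : U = Num.norm @^-1` [set x | x <= r] by [].
    by apply: closed_comp; [move=> x _; exact: norm_continuous|exact: closed_le].
  - by exists 0; rewrite /U /= normr0 ltW.
  exists x => _; split=> //.
  have {}xT : x = x - Phi x + a by [].
  by apply: (@addrI _ (x - Phi x)); rewrite -xT subrK.
have [psi psiP] := choice ex.
have lip a b : `|a| <= r / 2 -> `|b| <= r / 2 -> `|psi a - psi b| <= 2 * `|a - b|.
  move=> ar br; have [pa Pa] := psiP a ar; have [pb Pb] := psiP b br.
  have := PhiH _ _ pa pb; rewrite Pa Pb => H.
  have := ler_normD (a - b - (psi a - psi b)) (- (a - b)).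
  rewrite normrN addrC addrA addNr add0r normrN => H2.
  have : `|psi a - psi b| <= 2^-1 * `|psi a - psi b| + `|a - b|.
    by rewrite (le_trans H2)// lerD2r.
  by lra.
exists psi; split; first by move=> a ar; have [] := psiP a ar.
split=> //.
have r2 : `|0 : 'rV[R]_n| <= r / 2 by rewrite normr0 divr_ge0 ?ltW.
have [p0 P0] := psiP 0 r2.
have := PhiH _ 0 p0; rewrite normr0 ltW// => /(_ isT).
rewrite P0 Phi0 !subr0 sub0r normrN => H.
by apply/normr0_eq0; have := normr_ge0 (psi 0); lra.
Qed.

Lemma mulmx_bound (R : realType) (m n : nat) (B : 'M[R]_(n, m)) :
  exists2 C : R, 0 < C & forall x : 'rV[R]_n, `|x *m B| <= C * `|x|.
Proof.
exists (1 + \sum_i \sum_j `|B i j|).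
  by rewrite ltr_pwDl// sumr_ge0// => i _; rewrite sumr_ge0.
move=> x; apply/row_norm_leP => [|j].
  by rewrite mulr_ge0// addr_ge0// sumr_ge0// => i _; rewrite sumr_ge0.
rewrite mxE (le_trans (ler_norm_sum _ _ _))//.
apply: (@le_trans _ _ (\sum_i `|x| * `|B i j|)).
  by apply: ler_sum => i _; rewrite normrM ler_wpM2r// row_coord_le.
rewrite -mulr_sumr mulrC ler_wpM2r//.
apply: (@le_trans _ _ (\sum_i \sum_j `|B i j|)); last by rewrite lerDr.
apply: ler_sum => i _; rewrite (bigD1 j)//= lerDl sumr_ge0//.
Qed.

(** Strict differentiability entails differentiability, so the matrix [D] is the
Jacobian matrix, which by itself is meaningful for differentiable maps only. *)
Lemma jacobian_strict (R : realType) (m n : nat) (A : 'rV[R]_m -> 'rV[R]_n)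
   (D : 'M[R]_(m, n)) :
  (forall e, 0 < e -> exists2 s, 0 < s & forall x y, `|x| < s -> `|y| < s ->
    `|A x - A y - (x - y) *m D| <= e * `|x - y|) ->
  'J A 0 = D.
Proof.
move=> H.
have -> : 'J A 0 = lin1_mx (mulmxr D).
  rewrite /jacobian; congr lin1_mx.
  apply: (@diff_unique _ _ _ A (mulmxr D)).
    move=> x; have [C C0 CH] := mulmx_bound D.
    apply/(@cvgrPdist_le _ _ _ _ (nbhs_filter x)) => e e0.
    apply/(@nbhs_ballP R 'rV[R]_m); exists (e / C); first by rewrite /= divr_gt0.
    move=> y; rewrite -ball_normE /= -mulmxBl => xy; rewrite (le_trans (CH _))//.
    by rewrite mulrC -ler_pdivlMr// ltW.
  apply/eqaddoP => e e0; have [s s0 sH] := H e e0.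
  apply/(@nbhs_norm0P R 'rV[R]_m); exists s => //= x xs.
  have := sH x 0 xs; rewrite normr0 s0 => /(_ isT); rewrite !subr0.
  by congr (`|_| <= _); rewrite !fctE /= /shift /= addr0 opprD addrA.
by apply/row_matrixP => i; rewrite !rowE mul_rV_lin1.
Qed.

(** Composing with a right inverse [B] of [D] reduces to a map of ['rV_n] to itself
that is close to the identity. *)
Lemma submersion_section (R : realType) (m n : nat) (A : 'rV[R]_m -> 'rV[R]_n)
   (D : 'M[R]_(m, n)) : A 0 = 0 -> \rank D = n ->
  (forall e, 0 < e -> exists2 s, 0 < s & forall x y, `|x| < s -> `|y| < s ->
    `|A x - A y - (x - y) *m D| <= e * `|x - y|) ->
  exists sec : 'rV[R]_n -> 'rV[R]_m, exists r C : R, [/\ 0 < r, 0 < C, sec 0 = 0,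
    forall a, `|a| <= r -> A (sec a) = a &
    forall a b, `|a| <= r -> `|b| <= r -> `|sec a - sec b| <= C * `|a - b|].
Proof.
move=> A0 rD H.
have [B BD] : exists B : 'M[R]_(n, m), B *m D = 1%:M by apply/row_fullP; rewrite /row_full rD eqxx.
have [C C0 CH] := mulmx_bound B.
have [s s0 sH] : exists2 s, 0 < s & forall x y, `|x| < s -> `|y| < s ->
    `|A x - A y - (x - y) *m D| <= 2^-1 / C * `|x - y|.
  by apply: H; rewrite divr_gt0.
pose r := s / 2 / C.
have r0 : 0 < r by rewrite !divr_gt0.
have Bs (x : 'rV[R]_n) : `|x| <= r -> `|x *m B| < s.
  move=> xr; rewrite (le_lt_trans (CH x))//.
  have : C * `|x| <= C * r by rewrite ler_wpM2l// ltW.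
  by move/le_lt_trans; apply; rewrite /r mulrCA mulfV ?gt_eqF// mulr1 ltr_pdivrMr// ltr_pMr// ltr1n.
have [||psi [psiA [psiL psi0]]] := @near_identity_inverse R n (fun x => A (x *m B)) r r0.
- by rewrite mul0mx.
- move=> x y /Bs xs /Bs ys; have := sH _ _ xs ys.
  rewrite -mulmxBl -mulmxA BD mulmx1 => /le_trans; apply.
  rewrite -mulrA ler_wpM2l// ?invr_ge0//.
  by rewrite mulrC ler_pdivrMr// mulrC CH.
exists (fun a => psi a *m B), (r / 2), (C * 2); split.
- by rewrite divr_gt0.
- by rewrite mulr_gt0.
- by rewrite psi0 mul0mx.
- exact: psiA.
- move=> a b ar br; rewrite -mulmxBl (le_trans (CH _))// -mulrA ler_wpM2l ?(ltW C0)//.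
  exact: psiL.
Qed.

(** * A local model of the displacement *)

(** What the proof retains from the hypotheses on [S] and [K], on balls of radius
[r] around the origin: [F j] is the derivative of order [j] of [S] in [q], and
[k s p] is [K s (s ^ nu) p], with derivatives [k1] and [k2] in [s]. *)
Record local_model (R : realType) (m n nu : nat)
    (Delta S : R -> 'rV[R]_m -> R) (c d : R)
    (F : nat -> R -> 'rV[R]_m -> R) (k k1 k2 : R -> 'rV[R]_m -> R)
    (r M : R) : Prop := LocalModel {
  lm_r : 0 < r;
  lm_M : 0 < M;
  lm_c : c != 0;
  lm_d : d != 0;
  lm_Delta : forall q p, `|q| < r -> `|p| < r ->
    Delta q p = F 0%N q p + seam_root nu q ^+ nu.+1 * k (seam_root nu q) p;
  lm_F : forall j (q : R) p, (j <= n)%N -> `|q| < r -> `|p| < r ->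
    is_derive q 1 (F j ^~ p) (F j.+1 q p);
  lm_Fcont : forall j (e : R), (j <= n.+1)%N -> 0 < e -> exists2 s, 0 < s &
    forall q p, `|q| < s -> `|p| < s -> `|F j q p - F j 0 0| < e;
  lm_Fp : forall j (i : 'I_m), (j <= n)%N -> exists G : 'rV[R]_m -> R,
    (forall p, `|p| < r -> is_derive p (delta_mx 0 i) (F j 0) (G p)) /\
    (forall e : R, 0 < e -> exists2 s, 0 < s &
       forall p : 'rV[R]_m, `|p| < s -> `|G p - G 0| < e);
  lm_F0 : forall j, (j < n)%N -> F j 0 0 = 0;
  lm_Fn : F n 0 0 = n`!%:R * c;
  lm_coef : forall j p, (j <= n)%N -> `|p| < r -> coefS S j p = F j 0 p / j`!%:R;
  lm_k : forall s p, 0 < s < r -> `|p| < r ->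
    [/\ is_derive s 1 (k ^~ p) (k1 s p), is_derive s 1 (k1 ^~ p) (k2 s p),
       `|k1 s p| <= M & `|k2 s p| <= M];
  lm_kd : forall e, 0 < e -> exists2 s, 0 < s &
    forall q p, 0 <= q < s -> `|p| < s -> `|k q p - d| < e }.

Lemma derive1n_chain (R : realType) (n : nat) (f : nat -> R -> R) (r : R) :
  (forall j (q : R), (j <= n)%N -> `|q| < r -> is_derive q 1 (f j) (f j.+1 q)) ->
  forall j q, (j <= n.+1)%N -> `|q| < r -> derive1n j (f 0%N) q = f j q.
Proof.
move=> fd; elim=> // j IH q jn qr; rewrite /derive1n iterS -/(derive1n j (f 0%N)).
rewrite derive1E; have := @derive_val _ _ _ _ _ _ _ (fd j q jn qr) => <-.
apply: near_eq_derive.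
apply/nbhs_ballP; exists (r - `|q|); first by rewrite /= subr_gt0.
move=> x; rewrite /ball /= distrC ltrBrDr => xq; apply: IH; first exact: leqW.
by apply: le_lt_trans xq; rewrite -{1}(subrK q x) ler_normD.
Qed.

Lemma ramified_local_model (R : realType) (m n nu : nat)
    (Delta S : R -> 'rV[R]_m -> R) (K : R -> R -> 'rV[R]_m -> R) :
  (1 < nu)%N -> ramified_displacement n nu Delta S K ->
  exists (F : nat -> R -> 'rV[R]_m -> R) (k k1 k2 : R -> 'rV[R]_m -> R) (r M : R),
    local_model n nu Delta S (coefS S n 0) (K 0 0 0) F k k1 k2 r M.
Proof.
move=> nu1 [DE [U oU SU] [W oW KW] S0 [c0 d0]].
have nu0 : (0 < nu)%N by exact: ltnW.
have [F [r1 [F0 r10 Fd Fc Fp]]] := smooth_part_data oU SU.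
have [k1 [k2 [r2 [M [r20 M0 kH]]]]] := curve_derivatives oW nu1 KW.
have [r3 r30 DH] := near_pair0 DE.
pose k s p := K s (s ^+ nu) p.
pose r := Num.min r1 (Num.min r2 r3).
have r0 : 0 < r by rewrite !lt_min r10 r20.
have coefE j p : (j <= n.+1)%N -> `|p| < r -> derive1n j (S ^~ p) 0 = F j 0 p.
  move=> jn pr; rewrite -F0.
  apply: (@derive1n_chain R n (fun j => F j ^~ p) r1) => //; last by rewrite normr0.
  by move=> i q ilt qr; apply: Fd => //; rewrite (lt_le_trans pr)// /r ge_min lexx.
have fact0 j : (j`!%:R : R) != 0 by rewrite pnatr_eq0 -lt0n fact_gt0.
exists F, k, k1, k2, r, M; split => //.
- move=> q p; rewrite !lt_min => /and3P[qr1 qr2 qr3] /and3P[pr1 pr2 pr3].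
  rewrite (DH q p)// F0 /= powR_posp// -/(seam_root nu q) /k seam_rootXn//.
  have [q0|q0] := leP 0 q; first by rewrite posp_id.
  by rewrite seam_root_le0 ?ltW// expr0n !mul0r.
- move=> j q p jn; rewrite !lt_min => /andP[qr _] /andP[pr _]; exact: Fd.
- move=> j i jn; have [G [Gd Gc]] := Fp j i jn; exists G; split=> // p.
  by rewrite lt_min => /andP[pr _]; exact: Gd.
- by move=> j jn; rewrite -coefE ?normr0 ?S0 ?(ltnW (leqW _))// leqW// ltnW.
- by rewrite /coefS coefE ?normr0// mulrC divfK.
- by move=> j p jn pr; rewrite /coefS coefE// leqW.
- move=> s p /andP[s0]; rewrite !lt_min => /and3P[_ sr2 _] /and3P[_ pr2 _].
  by apply: kH; rewrite ?s0.
- move=> e e0; have [s s0 sH] := Ck_on_curve_near oW nu0 KW e0.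
  by exists s => // q p qs ps; have [] := sH q p qs ps.
Qed.

(** The parameter can be chosen so that the Taylor coefficients of order less than
[n] are any prescribed small numbers, in a Lipschitz way. *)
Lemma coef_section (R : realType) (m n nu : nat)
  (Delta S : R -> 'rV[R]_m -> R) (c d : R)
  (F : nat -> R -> 'rV[R]_m -> R) (k k1 k2 : R -> 'rV[R]_m -> R) (r M : R) :
  local_model n nu Delta S c d F k k1 k2 r M ->
  \rank ('J (coefA n S) 0) = n ->
  exists sec : 'rV[R]_n -> 'rV[R]_m, exists r0 C : R, [/\ 0 < r0, 0 < C, sec 0 = 0,
    forall a, `|a| <= r0 -> coefA n S (sec a) = a &
    forall a b, `|a| <= r0 -> `|b| <= r0 -> `|sec a - sec b| <= C * `|a - b|].
Proof.
move=> LM rk; have r0 := lm_r LM.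
have fact0 j : 1 <= (j`!%:R : R) by rewrite ler1n fact_gt0.
have exG (ji : 'I_n * 'I_m) : exists G : 'rV[R]_m -> R,
    (forall p, `|p| < r -> is_derive p (delta_mx 0 ji.2) (F ji.1 0) (G p)) /\
    (forall e : R, 0 < e -> exists2 s, 0 < s &
       forall p : 'rV[R]_m, `|p| < s -> `|G p - G 0| < e).
  by apply: (lm_Fp LM); exact: ltnW.
have [G GP] := choice exG.
pose D : 'M[R]_(m, n) := \matrix_(i, j) (G (j, i) 0 / j`!%:R).
have A0 : coefA n S 0 = 0.
  apply/rowP => j; rewrite !mxE (lm_coef LM) ?normr0//; last exact: ltnW.
  by rewrite (lm_F0 LM)// mul0r.
have H e : 0 < e -> exists2 s, 0 < s & forall x y, `|x| < s -> `|y| < s ->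
    `|coefA n S x - coefA n S y - (x - y) *m D| <= e * `|x - y|.
  move=> e0.
  have exs (j : 'I_n) : exists s, 0 < s /\ forall x y, `|x| < s -> `|y| < s ->
      `|F j 0 x - F j 0 y - \sum_i (x 0 i - y 0 i) * G (j, i) 0| <= e * `|x - y|.
    have [||s s0 sH] := @strict_differentiability R m (F j 0) (fun i => G (j, i)) r r0 _ _ e e0.
    - by move=> i; have [] := GP (j, i).
    - by move=> i; have [] := GP (j, i).
    by exists s.
  have [s sP] := choice exs.
  exists (\big[Num.min/r]_j s j).
    by apply: lt_bigmin => // j _; have [] := sP j.
  move=> x y xs ys; apply/row_norm_leP => [|j]; first by rewrite mulr_ge0// ltW.
  have sj : \big[Num.min/r]_j s j <= s j by exact: bigmin_le.
  have sr : \big[Num.min/r]_j s j <= r by exact: bigmin_le_id.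
  have [_ /(_ x y (lt_le_trans xs sj) (lt_le_trans ys sj)) sH] := sP j.
  rewrite !mxE !(lm_coef LM) ?(lt_le_trans xs)// ?(lt_le_trans ys)// ?(ltnW (ltn_ord j))//.
  have -> : \sum_i (x - y) 0 i * D i j =
     (\sum_i (x 0 i - y 0 i) * G (j, i) 0) / j`!%:R.
    by rewrite mulr_suml; apply: eq_bigr => i _; rewrite !mxE mulrA.
  rewrite -!mulrBl normrM normfV normr_nat (le_trans _ sH)//.
  by rewrite ler_pdivrMr ?ler_peMr// (lt_le_trans ltr01).
have JD := jacobian_strict H; rewrite JD in rk.
exact: submersion_section A0 rk H.
Qed.

(** * The upper bound *)

Section upper.
Variables (R : realType) (m n nu : nat).
Variables (Delta S : R -> 'rV[R]_m -> R) (c d : R).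
Variables (F : nat -> R -> 'rV[R]_m -> R) (k k1 k2 : R -> 'rV[R]_m -> R) (r M : R).
Hypothesis n1 : (1 < n)%N.
Hypothesis nu1 : (1 < nu)%N.
Hypothesis LM : local_model n nu Delta S c d F k k1 k2 r M.

Definition model_slope (p : 'rV[R]_m) := displacement_slope nu (F 1%N ^~ p) (k ^~ p) (k1 ^~ p).

(** All that the counting of zeros needs, on a ball whose radius is the same for all
small parameters. *)
Lemma local_shape : exists2 rho : R, 0 < rho <= r & forall p, `|p| < rho ->
  [/\ forall q : R, `|q| < rho -> is_derive q 1 (Delta ^~ p) (model_slope p q),
      forall q, q <= 0 -> model_slope p q = F 1%N q p,
      forall x y, 0 <= x -> x < y -> y < rho ->
         0 < d * (model_slope p y - model_slope p x) &
      forall q, `|q| < rho -> 0 < c * F n q p].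
Proof.
case: LM => r0 M0 c0 d0 DE Fd Fc Fp F0 Fn coef kd kc.
have [s2 s20 H2] := Fc 2 1 (leqW n1) ltr01.
have [sn sn0 Hn] : exists2 s, 0 < s &
    forall q p, `|q| < s -> `|p| < s -> `|F n q p - F n 0 0| < `|c| / 2.
  by apply: Fc; [exact: leqnSn|rewrite divr_gt0// normr_gt0].
have [sk sk0 Hk] : exists2 s, 0 < s &
    forall q p, 0 <= q < s -> `|p| < s -> `|k q p - d| < `|d| / 4.
  by apply: kc; rewrite divr_gt0// normr_gt0.
(* A common bound for [k1], [k2] and the second derivative of [S]. *)
pose M2 := M + `|F 2 0 0| + 1.
have M20 : 0 < M2 by rewrite /M2 -addrA ltr_pwDl// addr_ge0.
pose N : R := nu%:R ^+ 2 + nu%:R + 4.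
have N0 : 0 < N by rewrite /N ltr_wpDl// addr_ge0// exprn_ge0.
have [sigma [sigma0 sg1 sgM sgk sgr]] : exists sg : R,
    [/\ 0 < sg, sg <= 1, sg <= `|d| / 4 / (M2 * N), sg <= sk & sg <= r].
  exists (Num.min (Num.min 1 (`|d| / 4 / (M2 * N))) (Num.min sk r)).
  split; last 4 first; try by rewrite !ge_min !lexx ?orbT.
  by rewrite !lt_min ltr01 sk0 r0 divr_gt0 ?divr_gt0 ?normr_gt0// mulr_gt0.
have sgn0 : 0 < sigma ^+ nu by rewrite exprn_gt0.
have [rho [rho0 rh2 rhn rhs rhg]] : exists rho : R,
    [/\ 0 < rho, rho <= s2, rho <= sn, rho <= sigma ^+ nu & rho <= sigma].
  exists (Num.min (Num.min s2 sn) (Num.min (sigma ^+ nu) sigma)).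
  split; last 4 first; try by rewrite !ge_min !lexx ?orbT.
  by rewrite !lt_min s20 sn0 sgn0 sigma0.
exists rho; first by rewrite rho0 (le_trans rhg).
move=> p pr.
have rr : rho <= r by exact: le_trans sgr.
have sub (x y : R) : rho <= y -> x < rho -> x < y by move=> ry xr; exact: lt_le_trans ry.
have pr' := sub _ _ rr pr.
have H1 : 0 < sigma <= 1 by rewrite sigma0.
have H3 : 0 < rho <= sigma ^+ nu by rewrite rho0.
have H4 : M2 * sigma * N < `|d| / 2.
  rewrite mulrAC -ltr_pdivlMl ?mulr_gt0// mulrC (le_lt_trans sgM)//.
  rewrite ltr_pM2r ?invr_gt0 ?mulr_gt0// ltr_pM2l ?normr_gt0//.
  by rewrite ltf_pV2 ?posrE// ltr_nat.
have MM2 x : `|x| <= M -> `|x| <= M2.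
  by move=> xM; rewrite (le_trans xM)// /M2 -addrA lerDl addr_ge0.
have sr s : 0 < s < sigma -> 0 < s < r by case/andP=> -> /lt_le_trans; apply.
have D0 (q : R) : `|q| < rho -> is_derive q 1 (F 0%N ^~ p) (F 1%N q p).
  by move=> qr; apply: Fd => //; exact: sub qr.
have D1 (q : R) : `|q| < rho -> is_derive q 1 (F 1%N ^~ p) (F 2 q p).
  by move=> qr; apply: Fd => //; [exact: ltnW|exact: sub qr].
have D2 (q : R) : `|q| < rho -> `|F 2 q p| <= M2.
  move=> qr; have := H2 q p (sub _ _ rh2 qr) (sub _ _ rh2 pr).
  have := ler_normD (F 2 q p - F 2 0 0) (F 2 0 0); rewrite subrK /M2.
  have := ltW M0; lra.
have E1 (s : R) : 0 < s < sigma -> is_derive s 1 (k ^~ p) (k1 s p).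
  by move=> /sr ss; have [] := kd s p ss pr'.
have E2 (s : R) : 0 < s < sigma -> is_derive s 1 (k1 ^~ p) (k2 s p).
  by move=> /sr ss; have [] := kd s p ss pr'.
have E3 (s : R) : 0 < s < sigma -> `|k1 s p| <= M2.
  by move=> /sr ss; have [_ _ + _] := kd s p ss pr'; exact: MM2.
have E4 (s : R) : 0 < s < sigma -> `|k2 s p| <= M2.
  by move=> /sr ss; have [_ _ _] := kd s p ss pr'; exact: MM2.
have E5 (s : R) : 0 <= s < sigma -> `|k s p - d| <= `|d| / 4.
  move=> /andP[s0 ss]; apply/ltW/Hk; first by rewrite s0 (lt_le_trans ss).
  by apply: sub pr; exact: le_trans sgk.
have DE' (q : R) : `|q| < rho ->
    Delta q p = F 0%N q p + seam_root nu q ^+ nu.+1 * k (seam_root nu q) p.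
  by move=> qr; apply: DE => //; exact: sub qr.
split.
- by move=> q qr; apply: (is_derive_displacement nu1 H1 H3 D0 E1 E5 DE').
- by move=> q q0; rewrite /model_slope displacement_slope_le0.
- exact: (displacement_slope_increasing nu1 H1 H3 M20 H4 D1 D2 E1 E2 E3 E4 E5).
- move=> q qr; have := Hn q p (sub _ _ rhn qr) (sub _ _ rhn pr); rewrite Fn.
  have f1 : 1 <= (n`!%:R : R) by rewrite ler1n fact_gt0.
  rewrite ltr_norml => /andP[H5 H6].
  have [cn|cp|c00] := ltgtP c 0; last by rewrite c00 eqxx in c0.
    rewrite nmulr_rgt0//; move: H6; rewrite ltr0_norm//; nra.
  rewrite pmulr_rgt0//; move: H5; rewrite gtr0_norm//; nra.
Qed.

End upper.

Lemma local_zeros_bound (R : realType) (m n nu : nat)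
  (Delta S : R -> 'rV[R]_m -> R) (c d : R)
  (F : nat -> R -> 'rV[R]_m -> R) (k k1 k2 : R -> 'rV[R]_m -> R) (r M : R) :
  (1 < n)%N -> (1 < nu)%N -> local_model n nu Delta S c d F k k1 k2 r M ->
  exists2 rho : R, 0 < rho & forall p, `|p| < rho -> forall s, sorted <%R s ->
    zeros_in (- rho) rho (Delta ^~ p) s ->
    (size s <= if (0 < c * d)%R then n else n.+1)%N.
Proof.
move=> n1 nu1 LM; have [rho /andP[rho0 rr] H] := local_shape n1 nu1 LM.
exists rho => // p pr s ss s0; have [H1 H2 H3 H4] := H p pr.
(* The derivative in [q] starts the chain, which thus has [n - 1] steps. *)
have nE : n = n.-1.+1 by rewrite prednK// ltnW.
have aN (y : R) : - rho < y < rho -> `|y| < rho by rewrite ltr_norml.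
have := @size_zeros_ramified R (- rho) rho (Delta ^~ p) (fun j => F j.+1 ^~ p) n.-1
   c d (model_slope nu F k k1 p) s.
rewrite oppr_lt0 -nE => K.
have : (size s <= ~~ (0 < c * d)%R + n)%N.
  apply: K => //.
  - move=> i y ilt /aN yr; apply: (lm_F LM); rewrite ?(lt_le_trans _ rr)//.
    by rewrite nE ltnS ltnW.
  - by move=> y /aN; exact: H4.
  - by move=> y /aN; exact: H1.
  - by move=> y /andP[_ y0]; exact: H2.
by case: ifP.
Qed.

(** * Parameters realizing prescribed roots *)

Section path.
Variables (R : realType) (m n nu : nat).
Variables (Delta S : R -> 'rV[R]_m -> R) (c d : R).
Variables (F : nat -> R -> 'rV[R]_m -> R) (k k1 k2 : R -> 'rV[R]_m -> R) (r M : R).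
Hypothesis n1 : (1 < n)%N.
Hypothesis nu1 : (1 < nu)%N.
Hypothesis LM : local_model n nu Delta S c d F k k1 k2 r M.
Variables (sec : 'rV[R]_n -> 'rV[R]_m) (r0 C : R).
Hypotheses (r00 : 0 < r0) (C0 : 0 < C) (sec0 : sec 0 = 0).
Hypothesis secK : forall a, `|a| <= r0 -> coefA n S (sec a) = a.
Hypothesis secL : forall a b, `|a| <= r0 -> `|b| <= r0 ->
  `|sec a - sec b| <= C * `|a - b|.
Variable ra : 'I_n -> R.
Hypothesis ra0 : forall j, 0 < ra j.

(** The polynomial with roots [- ra j], the limit of [S (t * x) / (c * t ^ n)]. *)
Definition limit_poly : {poly R} := \prod_(j < n) ('X - (- ra j)%:P).
Local Notation P := limit_poly.

Lemma size_limit_poly : size P = n.+1.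
Proof. by rewrite size_prod_XsubC /index_enum -enumT size_enum_ord. Qed.

Lemma lead_limit_poly : P`_n = 1.
Proof.
have /monicP := monic_prod_XsubC (index_enum 'I_n) xpredT (fun j => - ra j).
by rewrite /lead_coef -/P size_limit_poly.
Qed.

Lemma horner_limit_poly x : P.[x] = \prod_j (x + ra j).
Proof.
rewrite horner_prod; apply: eq_bigr => j _.
by rewrite hornerXsubC opprK.
Qed.

(** The coefficients of [c * \prod_j (q + t * ra j)] of order less than [n]. *)
Definition target (t : R) : 'rV[R]_n := \row_j (c * t ^+ (n - j) * P`_j).

(** The polynomial [c * \prod_j (q + t * ra j)] in [q]; see [target_poly_horner]. *)
Definition target_poly (t : R) : {poly R} := \poly_(j < n.+1) (c * t ^+ (n - j) * P`_j).

Definition param_path (t : R) := sec (target t).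

Lemma target0 : target 0 = 0.
Proof.
apply/rowP => j; rewrite !mxE expr0n subn_eq0 leqNgt ltn_ord /=.
by rewrite mulr0 mul0r.
Qed.

Lemma target_poly_horner t x : (target_poly t).[t * x] = c * t ^+ n * P.[x].
Proof.
rewrite horner_poly (@horner_coef_wide _ n.+1 P x) ?size_limit_poly// mulr_sumr.
apply: eq_bigr => j _; rewrite exprMn.
have -> : t ^+ n = t ^+ (n - j) * t ^+ j by rewrite -exprD subnK// -ltnS.
by ring.
Qed.

Lemma target_continuous t e : 0 < e -> \forall x \near t, `|target t - target x| < e.
Proof.
move=> e0.
have H : \forall x \near t, forall j : 'I_n,
    `|c * t ^+ (n - j) * P`_j - c * x ^+ (n - j) * P`_j| < e.
  apply: (@filter_forall _ _ (fun j : 'I_n => [set x |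
    `|c * t ^+ (n - j) * P`_j - c * x ^+ (n - j) * P`_j| < e]) _
     (nbhs_filter t)) => j.
  have : (fun x => c * x ^+ (n - j) * P`_j) @ t --> c * t ^+ (n - j) * P`_j.
    have h : x ^+ (n - j) @[x --> t] --> t ^+ (n - j) by exact: exprn_continuous.
    exact: cvgM (cvgM (cvg_cst c) h) (cvg_cst _).
  by move/cvgrPdist_lt => /(_ e e0).
apply: filterS H => x H; apply/row_norm_ltP => // j; rewrite !mxE; exact: H.
Qed.

Lemma param_path_continuous t : `|target t| < r0 -> {for t, continuous param_path}.
Proof.
move=> tr.
have t0 : 0 < r0 - `|target t| by rewrite subr_gt0.
apply/cvgrPdist_lt => e e0.
have eC : 0 < e / C by rewrite divr_gt0.
apply: filterS2 (target_continuous t t0) (target_continuous t eC) => x H1 H2.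
rewrite (le_lt_trans (secL _ _))//; [exact: ltW| |].
  rewrite -(subrK (target t) (target x)) (le_trans (ler_normD _ _))// distrC.
  by rewrite -lerBrDr ltW.
by rewrite mulrC -ltr_pdivlMr.
Qed.

Lemma target_small e : 0 < e -> \forall t \near 0^'+, `|target t| < e.
Proof.
move=> e0; have := target_continuous 0 e0; rewrite target0.
move=> /nbhs_norm0P[s /= s0 sH]; apply/near_right0P; exists s => // t /andP[t0 ts].
by have := sH t; rewrite /= gtr0_norm// sub0r normrN; exact.
Qed.

Lemma param_path_small e : 0 < e -> \forall t \near 0^'+, `|param_path t| < e.
Proof.
move=> e0; have eC : 0 < e / C by rewrite divr_gt0.
apply: filterS2 (target_small eC) (target_small r00) => t t1 t2.
rewrite -[param_path t]subr0 -sec0 /param_path (le_lt_trans (secL _ _))//; [exact: ltW| |].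
  by rewrite normr0 ltW.
by rewrite subr0 mulrC -ltr_pdivlMr.
Qed.

(** Along the path the Taylor polynomial of [S] is [target_poly t] up to a small
relative error on the coefficient of order [n]; the substitution [q = t * x]
makes the remainder small with respect to [t ^ n]. *)
Lemma path_expansion e : 0 < e -> exists2 rho : R, 0 < rho & \forall t \near 0^'+,
  forall x, `|t * x| < rho ->
    `|F 0%N (t * x) (param_path t) - c * t ^+ n * P.[x]| <= e * t ^+ n * `|x| ^+ n.
Proof.
move=> e0; have [s s0 sH] := lm_Fcont LM (leqnSn n) e0.
pose rho := Num.min r s.
have rho0 : 0 < rho by rewrite lt_min (lm_r LM).
exists rho => //.
have t_gt0 : \forall t \near (0 : R)^'+, 0 < t by exact: nbhs_right_gt.
have H1 := param_path_small rho0; have H2 := target_small r00.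
near=> t.
have t0 : 0 < t by near: t.
have pt : `|param_path t| < rho by near: t.
have /ltW tt : `|target t| < r0 by near: t.
move=> x xr.
have := pt; rewrite lt_min => /andP[ptr pts].
have coefp j : (j < n)%N -> F j 0 (param_path t) = j`!%:R * (target_poly t)`_j.
  move=> jn; have jn' : (j <= n)%N by exact: ltnW.
  have E : coefS S j (param_path t) = c * t ^+ (n - j) * P`_j.
    have := congr1 (fun v : 'rV_n => v 0 (Ordinal jn)) (secK tt).
    by rewrite /coefA /target mxE [RHS]mxE.
  have f0 : (j`!%:R : R) != 0 by rewrite pnatr_eq0 -lt0n fact_gt0.
  by rewrite coef_poly ltnS jn' -E (lm_coef LM jn' ptr) mulrC divfK.
have H3 j (q : R) : (j < n)%N -> `|q| < rho ->
    is_derive q 1 (F j ^~ (param_path t)) (F j.+1 q (param_path t)).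
  move=> jn; rewrite lt_min => /andP[qr _]; apply: (lm_F LM) => //; exact: ltnW.
have H4 q : `|q| < rho -> `|F n q (param_path t) - n`!%:R * (target_poly t)`_n| <= e.
  rewrite lt_min => /andP[_ qs]; rewrite coef_poly ltnSn subnn expr0 mulr1.
  by rewrite lead_limit_poly mulr1 -(lm_Fn LM) ltW// sH.
have := taylor_poly (f := fun j => F j ^~ (param_path t)) H3 (size_poly _ _) coefp H4 xr.
by rewrite target_poly_horner normrM (gtr0_norm t0) exprMn mulrA.
Unshelve. all: by end_near. Qed.

Hypothesis ra_lt : forall i j : 'I_n, (i < j)%N -> ra i < ra j.

(** With such an [eta] the intervals of radius [eta] around the [- ra j] are disjoint
and negative. *)
Lemma root_gap : exists2 eta : R, 0 < eta & (forall j, eta < ra j) /\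
  forall i j, i != j -> 2 * eta < `|ra i - ra j|.
Proof.
pose w (ij : 'I_n * 'I_n) := if ij.1 == ij.2 then ra ij.1 / 2 else `|ra ij.1 - ra ij.2| / 4.
have dist i j : i != j -> 0 < `|ra i - ra j|.
  rewrite normr_gt0 subr_eq0 => ij; have := ij; rewrite neq_ltn => /orP[]/ra_lt.
    by move/lt_eqF ->.
  by move/gt_eqF ->.
exists (\big[Num.min/1]_ij w ij).
  apply: lt_bigmin => // -[i j] _; rewrite /w /=; case: eqVneq => [_|ij].
    by rewrite divr_gt0.
  by rewrite divr_gt0// dist.
split=> [j|i j ij].
  have : \big[Num.min/1]_ij w ij <= w (j, j) by exact: bigmin_le.
  by rewrite /w /= eqxx; have := ra0 j; lra.
have : \big[Num.min/1]_ij w ij <= w (i, j) by exact: bigmin_le.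
by rewrite /w /= (negbTE ij); have := dist _ _ ij; lra.
Qed.

Section roots.
Variable eta : R.
Hypothesis eta0 : 0 < eta.
Hypothesis eta_ra : forall j, eta < ra j.
Hypothesis eta_gap : forall i j, i != j -> 2 * eta < `|ra i - ra j|.

(** All the factors other than [x + ra j] are at least [eta] in absolute value. This
bound serves twice: it gives the signs at the end points of the intervals, and
it locates the roots. *)
Lemma limit_poly_lower j x : `|x + ra j| <= eta ->
  `|x + ra j| * eta ^+ n.-1 <= `|P.[x]|.
Proof.
move=> xj; rewrite horner_limit_poly (bigD1 j)//= normrM ler_wpM2l//.
have -> : eta ^+ n.-1 = \prod_(i < n | i != j) eta.
  by rewrite prodr_const cardC1 card_ord.
rewrite normr_prod; apply: ler_prod => i ij; rewrite ltW//=.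
have := eta_gap ij; have := ler_normB (x + ra i) (x + ra j).
have -> : x + ra i - (x + ra j) = ra i - ra j by ring.
by move: xj; lra.
Qed.

(** The factors are paired: for [i != j] the two of them multiply to
[(ra i - ra j) ^ 2 - eta ^ 2 > 0], and for [i = j] to [- eta ^ 2]. *)
Lemma limit_poly_sign j : P.[- ra j + eta] * P.[- ra j - eta] < 0.
Proof.
rewrite !horner_limit_poly (bigD1 j)//= [X in _ * X](bigD1 j)//= mulrACA.
rewrite pmulr_llt0.
  rewrite (_ : (_ + _) * _ = - (eta ^+ 2)); last by ring.
  by rewrite oppr_lt0 exprn_gt0.
rewrite -big_split /=; apply: prodr_gt0 => i ij.
have -> : (- ra j + eta + ra i) * (- ra j - eta + ra i) =
   `|ra i - ra j| ^+ 2 - eta ^+ 2 by rewrite real_normK ?num_real//; ring.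
rewrite subr_gt0 ltr_pXn2r ?nnegrE ?(ltW eta0)//.
have := eta_gap ij; have := eta0; lra.
Qed.

Let X := \sum_j ra j + eta.

Let X0 : 0 < X.
Proof. by rewrite ltr_wpDl// sumr_ge0// => j _; exact: ltW. Qed.

Let le_X j x : `|x + ra j| <= eta -> `|x| <= X.
Proof.
move=> xj; have raj : ra j <= \sum_j ra j.
  by rewrite (bigD1 j)//= lerDl sumr_ge0// => i _; exact: ltW.
have := ler_normB (x + ra j) (ra j); rewrite addrK (gtr0_norm (ra0 j)).
by rewrite /X; move: xj raj; lra.
Qed.

Lemma same_sign_close (a A : R) : `|a - A| < `|A| -> 0 < a * A.
Proof.
rewrite ltr_norml; have [An|Ap|->] := ltgtP A 0.
- rewrite (ltr0_norm An) opprK => /andP[H1 H2]; rewrite nmulr_lgt0//; lra.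
- by rewrite (gtr0_norm Ap) => /andP[H1 H2]; rewrite pmulr_lgt0//; lra.
- by rewrite normr0 oppr0 => /andP[H1 H2]; move: (lt_trans H1 H2); rewrite ltxx.
Qed.

Lemma scaled_small e : 0 < e -> \forall t \near 0^'+, forall j x,
  `|x + ra j| <= eta -> `|t * x| < e.
Proof.
move=> e0; apply/near_right0P; exists (e / X); first by rewrite divr_gt0.
move=> t /andP[t0 te] j x /le_X xX; rewrite normrM gtr0_norm//.
by rewrite (le_lt_trans (_ : _ <= t * X))// ?ler_pM2l// -ltr_pdivlMr.
Qed.

Lemma neg_root_exists : \forall t \near 0^'+, forall j, exists x,
  `|x + ra j| <= eta /\ F 0%N (t * x) (param_path t) = 0.
Proof.
have c0 := lm_c LM; have rr0 := lm_r LM.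
have Xn0 : 0 < X ^+ n by rewrite exprn_gt0.
pose e := `|c| * (eta * eta ^+ n.-1) / 2 / X ^+ n.
have e0 : 0 < e by rewrite !divr_gt0// !mulr_gt0// ?normr_gt0// exprn_gt0.
have [rho rho0 H1] := path_expansion e0.
have H2 := scaled_small rho0; have H3 := scaled_small rr0.
have H4 := param_path_small rr0.
near=> t => j.
have t0 : 0 < t by near: t; exact: nbhs_right_gt.
have tE : forall x, `|t * x| < rho ->
    `|F 0%N (t * x) (param_path t) - c * t ^+ n * P.[x]| <= e * t ^+ n * `|x| ^+ n by near: t.
have trho : forall j x, `|x + ra j| <= eta -> `|t * x| < rho by near: t.
have tr : forall j x, `|x + ra j| <= eta -> `|t * x| < r by near: t.
have pr : `|param_path t| < r by near: t.
have sgn x : `|x + ra j| = eta -> 0 < F 0%N (t * x) (param_path t) * (c * t ^+ n * P.[x]).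
  move=> xe; have xle : `|x + ra j| <= eta by rewrite xe.
  apply: same_sign_close; rewrite (le_lt_trans (tE x (trho _ _ xle)))//.
  have := limit_poly_lower xle; rewrite xe => Pl.
  have xX : `|x| ^+ n <= X ^+ n.
    by apply: lerXn2r; rewrite ?nnegrE ?(ltW X0)//; exact: le_X xle.
  have tn0 : 0 < t ^+ n by rewrite exprn_gt0.
  rewrite !normrM (gtr0_norm tn0).
  apply: (@le_lt_trans _ _ (e * t ^+ n * X ^+ n)).
    by rewrite ler_wpM2l// mulr_ge0 ?ltW.
  have -> : e * t ^+ n * X ^+ n = `|c| * t ^+ n * (eta * eta ^+ n.-1 / 2).
    by rewrite /e; field; rewrite gt_eqF.
  rewrite ltr_pM2l ?mulr_gt0 ?normr_gt0// (lt_le_trans _ Pl)//.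
  rewrite ltr_pdivrMr// ltr_pMr ?ltr1n// mulr_gt0// exprn_gt0//.
have xp : `|- ra j + eta + ra j| = eta by rewrite addrAC addNr add0r gtr0_norm.
have xm : `|- ra j - eta + ra j| = eta by rewrite addrAC addNr add0r normrN gtr0_norm.
have sp := sgn _ xp; have sm := sgn _ xm.
have neg : F 0%N (t * (- ra j - eta)) (param_path t) *
    F 0%N (t * (- ra j + eta)) (param_path t) <= 0.
  have := mulr_gt0 sp sm; rewrite mulrACA.
  have -> : c * t ^+ n * P.[- ra j + eta] * (c * t ^+ n * P.[- ra j - eta]) =
     (c * t ^+ n) ^+ 2 * (P.[- ra j + eta] * P.[- ra j - eta]) by ring.
  have c2 : 0 < (c * t ^+ n) ^+ 2.
    by rewrite exprn_even_gt0//= mulf_neq0// expf_neq0// gt_eqF.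
  rewrite mulrC nmulr_rgt0; last by rewrite pmulr_rlt0// limit_poly_sign.
  by rewrite mulrC => /ltW.
have ab : t * (- ra j - eta) <= t * (- ra j + eta).
  by rewrite ler_pM2l//; have := eta0; lra.
have near_x q : t * (- ra j - eta) <= q <= t * (- ra j + eta) -> `|q / t + ra j| <= eta.
  move=> /andP[q1 q2].
  have q1' : - ra j - eta <= q / t by rewrite ler_pdivlMr// mulrC.
  have q2' : q / t <= - ra j + eta by rewrite ler_pdivrMr// mulrC.
  by rewrite ler_norml; apply/andP; split; move: q1' q2'; lra.
have tK q : t * (q / t) = q by rewrite mulrCA mulfV ?mulr1// gt_eqF.
have [q qb Fq] : exists2 q, t * (- ra j - eta) <= q <= t * (- ra j + eta) &
    F 0%N q (param_path t) = 0.
  apply: (IVT_root (df := fun q => F 1%N q (param_path t)) ab _ neg) => q qb.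
  by apply: (lm_F LM) => //; rewrite -(tK q); apply: (tr j); exact: near_x.
by exists (q / t); split; [exact: near_x|rewrite tK].
Unshelve. all: by end_near. Qed.

(** Any root in the interval around [- ra j] converges, so that no care is needed in
choosing the roots as functions of [t]. *)
Lemma neg_root_close e : 0 < e -> \forall t \near 0^'+, forall j x,
  `|x + ra j| <= eta -> F 0%N (t * x) (param_path t) = 0 -> `|x + ra j| <= e.
Proof.
move=> e0; have c0 := lm_c LM.
have Xn0 : 0 < X ^+ n by rewrite exprn_gt0.
have en0 : 0 < eta ^+ n.-1 by rewrite exprn_gt0.
pose e' := e * (`|c| * eta ^+ n.-1) / X ^+ n.
have e'0 : 0 < e' by rewrite divr_gt0// !mulr_gt0// normr_gt0.
have [rho rho0 H1] := path_expansion e'0.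
have H2 := scaled_small rho0.
near=> t => j x xe Fx.
have t0 : 0 < t by near: t; exact: nbhs_right_gt.
have tE : forall x, `|t * x| < rho ->
    `|F 0%N (t * x) (param_path t) - c * t ^+ n * P.[x]| <= e' * t ^+ n * `|x| ^+ n by near: t.
have trho : forall j x, `|x + ra j| <= eta -> `|t * x| < rho by near: t.
have tn0 : 0 < t ^+ n by rewrite exprn_gt0.
have := tE x (trho _ _ xe); rewrite Fx sub0r normrN !normrM (gtr0_norm tn0) => H.
have xX : `|x| ^+ n <= X ^+ n.
  by apply: lerXn2r; rewrite ?nnegrE ?(ltW X0)//; exact: le_X xe.
have := limit_poly_lower xe => Pl.
have H5 : `|c| * t ^+ n * (`|x + ra j| * eta ^+ n.-1) <= e' * t ^+ n * X ^+ n.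
  apply: (@le_trans _ _ (`|c| * t ^+ n * `|P.[x]|)).
    by rewrite ler_wpM2l// mulr_ge0// ltW.
  by apply: (le_trans H); rewrite ler_wpM2l// mulr_ge0 ?ltW.
have E : e' * t ^+ n * X ^+ n = `|c| * t ^+ n * (e * eta ^+ n.-1).
  by rewrite /e'; field; rewrite gt_eqF.
by move: H5; rewrite E ler_pM2l ?mulr_gt0 ?normr_gt0// ler_pM2r.
Unshelve. all: by end_near. Qed.

End roots.

(** Negative zeros of Delta are zeros of [S], and they are simple because [S] has
[n] of them. *)
Lemma negative_roots : exists q : 'I_n -> R -> R,
  [/\ forall e, 0 < e -> \forall t \near 0^'+, forall j, `|q j t| < e,
      \forall t \near 0^'+, injective (q ^~ t) /\
        (forall j, q j t < 0 /\ simple_root (Delta ^~ (param_path t)) (q j t)) &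
      forall j, q j t / t @[t --> 0^'+] --> - ra j].
Proof.
have [eta eta0 [eta_ra eta_gap]] := root_gap.
pose good j t x := `|x + ra j| <= eta /\ F 0%N (t * x) (param_path t) = 0.
(* Roots exist for small [t] only; elsewhere the choice is irrelevant. *)
have ex (jt : 'I_n * R) : exists x, (exists y, good jt.1 jt.2 y) -> good jt.1 jt.2 x.
  have [[y gy]|ngy] := pselect (exists y, good jt.1 jt.2 y); first by exists y.
  by exists 0 => gy; case: ngy.
have [x xP] := choice ex.
have Hex := neg_root_exists eta0 eta_gap.
have Hgood : \forall t \near 0^'+, forall j, good j t (x (j, t)).
  by apply: filterS Hex => t tex j; exact: (xP (j, t) (tex j)).
have [rho /andP[rho0 rr] shape] := local_shape n1 nu1 LM.
have Hp := param_path_small rho0.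
have small e : 0 < e -> \forall t \near 0^'+, forall j, `|t * x (j, t)| < e.
  move=> e0; have He := scaled_small eta0 e0; near=> t => j.
  have He' : forall j x, `|x + ra j| <= eta -> `|t * x| < e by near: t.
  have G : forall j, good j t (x (j, t)) by near: t.
  by apply: (He' j); have [] := G j.
exists (fun j t => t * x (j, t)); split => //.
- have Hs := small rho rho0.
  near=> t.
  have t0 : 0 < t by near: t; exact: nbhs_right_gt.
  have G : forall j, good j t (x (j, t)) by near: t.
  have pr : `|param_path t| < rho by near: t.
  have qs : forall j, `|t * x (j, t)| < rho by near: t.
  have inj : injective (fun j => t * x (j, t)).
    move=> i j /(mulfI (lt0r_neq0 t0)) xij; apply/eqP/negPn/negP => ij.
    have := eta_gap i j ij; have [Gi _] := G i; have [Gj _] := G j.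
    rewrite xij in Gi; have := ler_normB (x (j, t) + ra i) (x (j, t) + ra j).
    have -> : x (j, t) + ra i - (x (j, t) + ra j) = ra i - ra j by ring.
    by move: Gi Gj; lra.
  split=> // j; have [Gj Fj] := G j.
  have q0 : t * x (j, t) < 0.
    rewrite pmulr_rlt0//; move: Gj; rewrite ler_norml => /andP[_].
    by have := eta_ra j; lra.
  split=> //.
  have [S1 S2 _ S4] := shape _ pr.
  have dq := S1 _ (qs j); rewrite (S2 _ (ltW q0)) in dq.
  have lt_r y : `|y| < rho -> `|y| < r by move/lt_le_trans; exact.
  have aN (y : R) : - rho < y < rho -> `|y| < rho by rewrite ltr_norml.
  split.
  + rewrite (lm_Delta LM) ?lt_r// seam_root_le0 ?(ltW q0)//; last exact: ltnW.
    by rewrite expr0n mul0r addr0.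
  + exact: ex_derive.
  + rewrite derive1E (@derive_val _ _ _ _ _ _ _ dq).
    have nE : n = n.-1.+1 by rewrite prednK// ltnW.
    pose s := sort <=%R [seq t * x (i, t) | i <- enum 'I_n].
    apply: (@simple_of_size_zeros R (- rho) rho (fun i => F i ^~ (param_path t)) n.-1 c s);
      rewrite -?nE.
    * move=> i y ilt /aN yr; apply: (lm_F LM); [exact: ltnW|exact: lt_r|exact: lt_r].
    * by move=> y /aN; exact: S4.
    * by rewrite sort_lt_sorted map_inj_uniq ?enum_uniq.
    * apply/allP => y; rewrite mem_sort => /mapP[i _ ->].
      by rewrite -ltr_norml qs /=; apply/eqP; have [] := G i.
    * by rewrite size_sort size_map size_enum_ord.
    * by rewrite mem_sort; apply: map_f; rewrite mem_enum.
- move=> j; apply/cvgrPdist_le => e e0.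
  have Hc := neg_root_close eta0 eta_gap e0.
  near=> t.
  have t0 : 0 < t by near: t; exact: nbhs_right_gt.
  have G : forall j, good j t (x (j, t)) by near: t.
  have tc : forall j x, `|x + ra j| <= eta -> F 0%N (t * x) (param_path t) = 0 ->
    `|x + ra j| <= e by near: t.
  have [Gj Fj] := G j.
  rewrite mulrAC mulfV ?gt_eqF// mul1r -opprD normrN addrC; exact: tc.
Unshelve. all: by end_near. Qed.

Section ramified_root.
Hypothesis cd0 : c * d < 0.

Let nu0 : (0 < nu)%N. Proof. exact: ltnW. Qed.

Definition ramified_const := `|c / d| * \prod_(j < n) ra j.
(** The announced equivalent of the positive root, that is, the solution of
[q ^ (1 + 1 / nu) = ramified_const * t ^ n]; see [ramified_scaleX]. *)
Definition ramified_scale (t : R) :=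
  ramified_const `^ (nu%:R / nu.+1%:R) * t `^ ((n * nu)%:R / nu.+1%:R).

Let P0 := \prod_(j < n) ra j.

Let P00 : 0 < P0.
Proof. by apply: prodr_gt0 => j _. Qed.

Lemma limit_poly0 : P.[0] = P0.
Proof. by rewrite horner_limit_poly; apply: eq_bigr => j _; rewrite add0r. Qed.

Let c0 : c != 0. Proof. exact: lm_c LM. Qed.
Let d0 : d != 0. Proof. exact: lm_d LM. Qed.

Lemma ramified_const_gt0 : 0 < ramified_const.
Proof. by rewrite mulr_gt0// normr_gt0 mulf_neq0// invr_eq0. Qed.

Lemma ramified_const_d : ramified_const * d = - c * P0.
Proof.
rewrite /ramified_const -/P0 ltr0_norm; first by field.
have -> : c / d = (c * d) / d ^+ 2 by field.
by rewrite pmulr_llt0// invr_gt0 exprn_even_gt0.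
Qed.

Lemma ramified_scale_gt0 t : 0 < t -> 0 < ramified_scale t.
Proof. by move=> t0; rewrite mulr_gt0 ?powR_gt0// ramified_const_gt0. Qed.

Lemma ramified_scaleX t : 0 < t ->
  seam_root nu (ramified_scale t) ^+ nu.+1 = ramified_const * t ^+ n.
Proof.
move=> t0; have nuR : (nu%:R : R) != 0 by rewrite pnatr_eq0 -lt0n.
have nuS : (nu.+1%:R : R) != 0 by rewrite pnatr_eq0.
have nuS' : (nu%:R + 1 : R) != 0 by rewrite natr1.
rewrite -powR_posp// posp_id ?ltW ?ramified_scale_gt0// /ramified_scale powRM ?powR_ge0//.
rewrite -!powRrM natrM.
have -> : nu%:R / nu.+1%:R * (1 + nu%:R^-1) = 1 :> R.
  by rewrite -natr1; field; rewrite nuR.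
have -> : n%:R * nu%:R / nu.+1%:R * (1 + nu%:R^-1) = n%:R :> R.
  by rewrite -natr1; field; rewrite nuR.
by rewrite powRr1 ?(ltW ramified_const_gt0)// powR_mulrn// ltW.
Qed.

(** Because [n * nu > nu + 1]: the positive root is much smaller than the negative
ones, and [S] is nearly constant up to it. *)
Lemma ramified_scale_over_t e : 0 < e -> \forall t \near 0^'+, ramified_scale t < e * t.
Proof.
move=> e0; pose B := ramified_const `^ (nu%:R / nu.+1%:R).
have B0 : 0 < B by rewrite powR_gt0// ramified_const_gt0.
pose kappa : R := (n * nu)%:R / nu.+1%:R - 1.
have kappa0 : 0 < kappa.
  rewrite subr_gt0 ltr_pdivlMr// mul1r ltr_nat.
  rewrite (leq_trans (_ : _ < 2 * nu)%N) ?leq_mul2r ?n1 ?orbT//.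
  by rewrite mul2n -addnn -addn1 ltn_add2l.
have eB : 0 < e / B by rewrite divr_gt0.
have := powR_cvg0 kappa0; move/cvgrPdist_lt => /(_ _ eB) H.
near=> t.
have t0 : 0 < t by near: t; exact: nbhs_right_gt.
have : `|0 - t `^ kappa| < e / B by near: t.
rewrite sub0r normrN ger0_norm ?powR_ge0// ltr_pdivlMr// => Ht.
rewrite /ramified_scale -/B.
have -> : (n * nu)%:R / nu.+1%:R = 1 + kappa :> R by rewrite /kappa addrCA subrr addr0.
rewrite powRD; last by apply/implyP => _; rewrite gt_eqF.
rewrite powRr1 ?ltW// mulrCA [e * t]mulrC ltr_pM2l//.
by rewrite mulrC.
Unshelve. all: by end_near. Qed.

Lemma ramified_scale_small e : 0 < e -> \forall t \near 0^'+, ramified_scale t < e.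
Proof.
move=> e0; have H := ramified_scale_over_t e0; near=> t.
have : ramified_scale t < e * t by near: t.
move/lt_le_trans; apply; rewrite ger_pMr//.
by near: t; exact: nbhs_right_le.
Unshelve. all: by end_near. Qed.

(** At [q = mu * ramified_scale t], [S] is close to [c * t ^ n * P0] and the ramified
term to [- c * t ^ n * P0 * mu ^ (1 + 1 / nu)]. *)
Lemma ramified_value mu e : 0 < mu -> 0 < e -> \forall t \near 0^'+,
  `|Delta (mu * ramified_scale t) (param_path t) -
      c * t ^+ n * (P0 * (1 - seam_root nu mu ^+ nu.+1))|
     <= e * t ^+ n.
Proof.
move=> mu0 e0; have e30 : 0 < e / 3 by rewrite divr_gt0.
have [rho rho0 H1] := path_expansion e30.
have r0' := lm_r LM.
pose L := seam_root nu mu ^+ nu.+1.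
have L0 : 0 < L by rewrite exprn_gt0// seam_root_gt0.
have LC0 : 0 < L * ramified_const by rewrite mulr_gt0// ramified_const_gt0.
have [s s0 Hs] := lm_kd LM (divr_gt0 e30 LC0).
have cn0 : 0 < `|c| by rewrite normr_gt0.
have [z z0 Hz] : exists2 z, 0 < z & forall x, `|x| < z -> `|P.[x] - P0| <= e / 3 / `|c|.
  have := @continuous_horner R P 0; move/cvgrPdist_le => /(_ _ (divr_gt0 e30 cn0)).
  move=> /nbhs_norm0P[z /= z0 zH]; exists z => // x xz.
  by rewrite -limit_poly0 distrC; exact: zH.
have w0 : 0 < Num.min 1 z by rewrite lt_min ltr01.
have H2 := ramified_scale_over_t (divr_gt0 w0 mu0).
have H3 := ramified_scale_small (divr_gt0 rho0 mu0).
have H4 := ramified_scale_small (divr_gt0 r0' mu0).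
have sn0 : 0 < s ^+ nu by rewrite exprn_gt0.
have H5 := ramified_scale_small (divr_gt0 sn0 mu0).
have H6 := param_path_small r0'. have H7 := param_path_small s0.
near=> t.
have t0 : 0 < t by near: t; exact: nbhs_right_gt.
have tn0 : 0 < t ^+ n by rewrite exprn_gt0.
pose q := mu * ramified_scale t.
have q0 : 0 < q by rewrite mulr_gt0// ramified_scale_gt0.
have lt_q y : ramified_scale t < y / mu -> q < y by rewrite ltr_pdivlMr// mulrC.
have qrho : q < rho by apply: lt_q; near: t.
have qr : q < r by apply: lt_q; near: t.
have qs : q < s ^+ nu by apply: lt_q; near: t.
have pr : `|param_path t| < r by near: t.
have ps : `|param_path t| < s by near: t.
have qt : q / t < Num.min 1 z.
  rewrite ltr_pdivrMr// /q mulrC -ltr_pdivlMr// mulrAC; near: t; exact: H2.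
have tE : forall x, `|t * x| < rho ->
    `|F 0%N (t * x) (param_path t) - c * t ^+ n * P.[x]| <= e / 3 * t ^+ n * `|x| ^+ n by near: t.
pose x := q / t.
have x0 : 0 < x by rewrite divr_gt0.
have tx : t * x = q by rewrite /x mulrCA mulfV ?mulr1// gt_eqF.
have [x1 xz] : x < 1 /\ x < z by move: qt; rewrite lt_min => /andP[].
have T1 : `|F 0%N q (param_path t) - c * t ^+ n * P.[x]| <= e / 3 * t ^+ n.
  have := tE x; rewrite tx gtr0_norm// => /(_ qrho) /le_trans; apply.
  rewrite ger_pMr ?mulr_gt0// gtr0_norm// exprn_ile1// ltW//.
have T2 : `|c * t ^+ n * (P.[x] - P0)| <= e / 3 * t ^+ n.
  rewrite !normrM (gtr0_norm tn0) mulrAC ler_pM2r//.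
  by rewrite mulrC -ler_pdivlMr// Hz// gtr0_norm.
have rq : seam_root nu q ^+ nu.+1 = L * ramified_const * t ^+ n.
  have -> : seam_root nu q = seam_root nu mu * seam_root nu (ramified_scale t).
    rewrite /seam_root !posp_id ?(ltW q0) ?(ltW mu0) ?(ltW (ramified_scale_gt0 t0))//.
    by rewrite powRM ?(ltW mu0) ?(ltW (ramified_scale_gt0 t0)).
  by rewrite exprMn ramified_scaleX// mulrA.
have T3 : `|L * ramified_const * t ^+ n * (k (seam_root nu q) (param_path t) - d)|
    <= e / 3 * t ^+ n.
  have Lt0 : 0 < L * ramified_const * t ^+ n by exact: mulr_gt0.
  rewrite normrM (gtr0_norm Lt0) mulrAC ler_pM2r// mulrC -ler_pdivlMr//.
  by apply/ltW/Hs => //; rewrite seam_root_ge0 seam_root_lt_exp.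
have qr' : `|q| < r by rewrite gtr0_norm.
rewrite -/q (lm_Delta LM qr' pr) rq -/L.
have -> : F 0%N q (param_path t) + L * ramified_const * t ^+ n * k (seam_root nu q) (param_path t) -
   c * t ^+ n * (P0 * (1 - L)) =
   (F 0%N q (param_path t) - c * t ^+ n * P.[x]) + c * t ^+ n * (P.[x] - P0) +
   L * ramified_const * t ^+ n * (k (seam_root nu q) (param_path t) - d) +
   L * t ^+ n * (ramified_const * d + c * P0).
  by ring.
rewrite ramified_const_d mulNr addNr mulr0 addr0.
apply: (le_trans (ler_normD _ _)); apply: (le_trans (lerD (ler_normD _ _) (lexx _))).
apply: (le_trans (lerD (lerD T1 T2) T3)).
by rewrite -!mulrDl ler_pM2r//; lra.
Unshelve. all: by end_near. Qed.

Lemma ramified_sign mu : 0 < mu -> mu != 1 -> \forall t \near 0^'+,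
  0 < Delta (mu * ramified_scale t) (param_path t) * (c * (1 - mu)).
Proof.
move=> mu0 mu1; pose L := seam_root nu mu ^+ nu.+1.
have rt1 : seam_root nu (1 : R) = 1 by rewrite -[X in seam_root _ X](expr1n R nu) seam_root_exp.
have Lmu : 0 < (1 - L) * (1 - mu).
  have [m1|m1|/eqP] := ltgtP mu 1; last by rewrite (negbTE mu1).
    rewrite mulr_gt0 ?subr_gt0// exprn_ilt1 ?seam_root_ge0// -rt1.
    by apply: seam_root_lt => //; exact: ltW.
  rewrite nmulr_rgt0 ?subr_lt0// exprn_egt1// -rt1.
  by apply: seam_root_lt.
have L1 : 1 - L != 0 by apply/eqP => L1; move: Lmu; rewrite L1 mul0r ltxx.
have e0 : 0 < `|c * (P0 * (1 - L))| / 2.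
  by rewrite divr_gt0// normr_gt0 !mulf_neq0// gt_eqF.
have H := ramified_value mu0 e0.
near=> t.
have t0 : 0 < t by near: t; exact: nbhs_right_gt.
have tn0 : 0 < t ^+ n by rewrite exprn_gt0.
have V : `|Delta (mu * ramified_scale t) (param_path t) - c * t ^+ n * (P0 * (1 - L))|
     <= `|c * (P0 * (1 - L))| / 2 * t ^+ n by near: t.
have : 0 < Delta (mu * ramified_scale t) (param_path t) * (c * t ^+ n * (P0 * (1 - L))).
  apply: same_sign_close; apply: (le_lt_trans V).
  rewrite [X in _ < `|X|](_ : _ = c * (P0 * (1 - L)) * t ^+ n); last by ring.
  rewrite [X in _ < X]normrM (gtr0_norm tn0) ltr_pM2r// gtr_pMr ?invf_lt1 ?ltr1n//.
  by rewrite normr_gt0 !mulf_neq0// gt_eqF.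
have -> : Delta (mu * ramified_scale t) (param_path t) * (c * t ^+ n * (P0 * (1 - L))) =
   (Delta (mu * ramified_scale t) (param_path t) * (c * (1 - L))) * (t ^+ n * P0) by ring.
have tP : 0 < t ^+ n * P0 by exact: mulr_gt0.
rewrite (pmulr_lgt0 _ tP) => D.
have := mulr_gt0 D Lmu.
have -> : Delta (mu * ramified_scale t) (param_path t) * (c * (1 - L)) * ((1 - L) * (1 - mu)) =
   Delta (mu * ramified_scale t) (param_path t) * (c * (1 - mu)) * (1 - L) ^+ 2 by ring.
by rewrite pmulr_lgt0// exprn_even_gt0.
Unshelve. all: by end_near. Qed.

Lemma ramified_root_exists e : 0 < e < 1 -> \forall t \near 0^'+,
  exists2 q, (1 - e) * ramified_scale t <= q <= (1 + e) * ramified_scale t &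
    Delta q (param_path t) = 0.
Proof.
move=> /andP[e0 e1].
have m0 : 0 < 1 - e by rewrite subr_gt0.
have p0 : 0 < 1 + e by rewrite addr_gt0.
have Hm := ramified_sign m0 (_ : 1 - e != 1).
have Hp := ramified_sign p0 (_ : 1 + e != 1).
have [rho /andP[rho0 rr] shape] := local_shape n1 nu1 LM.
have Hr := ramified_scale_small (divr_gt0 rho0 p0).
have Hpp := param_path_small rho0.
have {}Hm : \forall t \near 0^'+,
    0 < Delta ((1 - e) * ramified_scale t) (param_path t) * (c * (1 - (1 - e))).
  by apply: Hm; rewrite lt_eqF// gtrBl.
have {}Hp : \forall t \near 0^'+,
    0 < Delta ((1 + e) * ramified_scale t) (param_path t) * (c * (1 - (1 + e))).
  by apply: Hp; rewrite gt_eqF// ltrDl.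
near=> t.
have t0 : 0 < t by near: t; exact: nbhs_right_gt.
have g0 := ramified_scale_gt0 t0.
have pr : `|param_path t| < rho by near: t.
have gr : ramified_scale t < rho / (1 + e) by near: t.
have Dm : 0 < Delta ((1 - e) * ramified_scale t) (param_path t) * (c * (1 - (1 - e))) by near: t.
have Dp : 0 < Delta ((1 + e) * ramified_scale t) (param_path t) * (c * (1 - (1 + e))) by near: t.
have [S1 _ _ _] := shape _ pr.
apply: (IVT_root (df := model_slope nu F k k1 (param_path t))).
- by rewrite ler_pM2r//; lra.
- move=> q /andP[q1 q2]; apply: S1; rewrite gtr0_norm.
    by rewrite (le_lt_trans q2)// mulrC -ltr_pdivlMr.
  by rewrite (lt_le_trans _ q1)// mulr_gt0.
- have := mulr_gt0 Dm Dp.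
  set A := Delta _ _; set B := Delta _ _.
  have -> : A * (c * (1 - (1 - e))) * (B * (c * (1 - (1 + e)))) =
     - (A * B * (c * e) ^+ 2) by ring.
  rewrite oppr_gt0 pmulr_llt0; first exact: ltW.
  by rewrite exprn_even_gt0//= mulf_neq0// gt_eqF.
Unshelve. all: by end_near. Qed.

Lemma Delta0_sign : \forall t \near 0^'+, d * Delta 0 (param_path t) < 0.
Proof.
have H1 := target_small r00; have H2 := param_path_small (lm_r LM).
near=> t.
have t0 : 0 < t by near: t; exact: nbhs_right_gt.
have tt : `|target t| <= r0 by apply: ltW; near: t.
have pr : `|param_path t| < r by near: t.
have n0 : (0 < n)%N by exact: ltnW.
have E : coefS S 0 (param_path t) = c * t ^+ (n - 0) * P`_0.
  have := congr1 (fun v : 'rV_n => v 0 (Ordinal n0)) (secK tt).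
  by rewrite /coefA /target mxE [RHS]mxE.
have r0n : `|0 : R| < r by rewrite normr0 (lm_r LM).
rewrite (lm_Delta LM r0n pr) (seam_root_le0 nu0 (lexx 0)) expr0n mul0r addr0.
move: E; rewrite (lm_coef LM (leq0n n) pr) fact0 divr1 subn0 -horner_coef0 limit_poly0 => ->.
rewrite (_ : d * _ = c * d * (t ^+ n * P0)); last by ring.
by rewrite pmulr_llt0// mulr_gt0// exprn_gt0.
Unshelve. all: by end_near. Qed.

(** The increasing function [d * Delta_q] is positive somewhere before the first
positive root, as [d * Delta] rises from a negative value to 0; so it remains
positive afterwards. *)
Lemma ramified_root_unique : exists2 rho : R, 0 < rho & \forall t \near 0^'+,
  forall q, 0 < q < rho -> Delta q (param_path t) = 0 ->
    simple_root (Delta ^~ (param_path t)) q /\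
    forall q', 0 < q' < rho -> Delta q' (param_path t) = 0 -> q' = q.
Proof.
have [rho /andP[rho0 rr] shape] := local_shape n1 nu1 LM.
exists rho => //; have H1 := Delta0_sign; have H2 := param_path_small rho0.
near=> t.
have D0 : d * Delta 0 (param_path t) < 0 by near: t.
have pr : `|param_path t| < rho by near: t.
have [S1 _ S3 _] := shape _ pr.
have mvt x y : 0 <= x -> x < y -> y < rho -> exists2 z, x < z < y &
    Delta y (param_path t) - Delta x (param_path t) =
      model_slope nu F k k1 (param_path t) z * (y - x).
  move=> x0 xy yr; apply: (@MVT_interior R (Delta ^~ (param_path t))) => // z /andP[xz zy].
  by apply: S1; rewrite ger0_norm ?(le_trans x0)// (le_lt_trans zy).
have slope q : 0 < q < rho -> Delta q (param_path t) = 0 ->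
    exists2 z, 0 < z < q & 0 < d * model_slope nu F k k1 (param_path t) z.
  move=> /andP[q0 qr] Dq; have [z zq] := mvt 0 q (lexx _) q0 qr.
  rewrite Dq sub0r subr0 => E; exists z => //.
  rewrite -(pmulr_lgt0 _ q0) -mulrA -E mulrN oppr_gt0//.
have uniq2 x y : 0 < x -> x < y -> y < rho -> Delta x (param_path t) = 0 ->
    Delta y (param_path t) <> 0.
  move=> x0 xy yr Dx Dy; have [|z /andP[z0 zx] dz] := slope x _ Dx.
    by rewrite x0 (lt_trans xy).
  have [w /andP[xw wy]] := mvt x y (ltW x0) xy yr.
  rewrite Dx Dy subrr => /esym/eqP; rewrite mulf_eq0 subr_eq0 (gt_eqF xy) orbF => /eqP Dw.
  have := S3 z w (ltW z0) (lt_trans zx xw) (lt_trans wy yr).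
  by rewrite Dw sub0r mulrN oppr_gt0 => /(lt_trans dz); rewrite ltxx.
move=> q qb Dq; split.
  have [z /andP[z0 zq] dz] := slope q qb Dq; case/andP: qb => q0 qr.
  have qa : `|q| < rho by rewrite gtr0_norm.
  have dq := S1 q qa.
  split; [by []|exact: ex_derive|].
  rewrite derive1E (@derive_val _ _ _ _ _ _ _ dq).
  have := S3 z q (ltW z0) zq qr; rewrite mulrBr subr_gt0 => /(lt_trans dz).
  by move=> h; apply/eqP => h0; move: h; rewrite h0 mulr0 ltxx.
move=> q' /andP[q'0 q'r] Dq'; case/andP: qb => q0 qr.
have [qq|qq|//] := ltgtP q' q; exfalso.
  exact: (uniq2 q' q q'0 qq qr Dq' Dq).
exact: (uniq2 q q' q0 qq q'r Dq Dq').
Unshelve. all: by end_near. Qed.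

(** By uniqueness the root does not depend on the precision [e] of
[ramified_root_exists], which yields the asymptotics. *)
Lemma ramified_root : exists qram : R -> R,
  [/\ forall e, 0 < e -> \forall t \near 0^'+, `|qram t| < e,
      \forall t \near 0^'+, 0 < qram t /\ simple_root (Delta ^~ (param_path t)) (qram t) &
      forall e, 0 < e -> \forall t \near 0^'+,
        `|qram t - ramified_scale t| <= e * ramified_scale t].
Proof.
have [rho rho0 Hu] := ramified_root_unique.
have ex t : exists q, (exists q', 0 < q' < rho /\ Delta q' (param_path t) = 0) ->
    0 < q < rho /\ Delta q (param_path t) = 0.
  have [[q Hq]|nq] := pselect (exists q', 0 < q' < rho /\ Delta q' (param_path t) = 0).
    by exists q.
  by exists 0 => Hq; case: nq.
have [qram qP] := choice ex.
have close e : 0 < e < 1 -> \forall t \near 0^'+,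
    [/\ 0 < qram t, simple_root (Delta ^~ (param_path t)) (qram t) &
       `|qram t - ramified_scale t| <= e * ramified_scale t].
  move=> e01; have /andP[e0 e1] := e01.
  have He := ramified_root_exists e01.
  have Hs := ramified_scale_small (divr_gt0 rho0 (addr_gt0 ltr01 e0)).
  near=> t.
  have t0 : 0 < t by near: t; exact: nbhs_right_gt.
  have g0 := ramified_scale_gt0 t0.
  have gr : ramified_scale t < rho / (1 + e) by near: t.
  have [q /andP[q1 q2] Dq] :
    exists2 q, (1 - e) * ramified_scale t <= q <= (1 + e) * ramified_scale t &
    Delta q (param_path t) = 0 by near: t.
  have U : forall q, 0 < q < rho -> Delta q (param_path t) = 0 ->
    simple_root (Delta ^~ (param_path t)) q /\
    forall q', 0 < q' < rho -> Delta q' (param_path t) = 0 -> q' = q by near: t.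
  have qb : 0 < q < rho.
    apply/andP; split; first by rewrite (lt_le_trans _ q1)// mulr_gt0// subr_gt0.
    by rewrite (le_lt_trans q2)// mulrC -ltr_pdivlMr// addr_gt0.
  have [sq uq] := U q qb Dq.
  have [qrb Dqr] : 0 < qram t < rho /\ Delta (qram t) (param_path t) = 0.
    by apply: qP; exists q.
  have -> : qram t = q by exact: uq.
  split => //; first by case/andP: qb.
  by rewrite ler_norml; apply/andP; split; move: q1 q2; lra.
have h12 : 0 < (2^-1 : R) < 1 by rewrite invr_gt0 ltr0n /= invf_lt1// ltr1n.
exists qram; split.
- move=> e e0; have Hc := close _ h12; have Hs := ramified_scale_small (divr_gt0 e0 (ltr0n R 2)).
  near=> t.
  have [q0 _ H] : [/\ 0 < qram t, simple_root (Delta ^~ (param_path t)) (qram t) &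
       `|qram t - ramified_scale t| <= 2^-1 * ramified_scale t] by near: t.
  have g2 : ramified_scale t < e / 2%:R by near: t; exact: Hs.
  by rewrite gtr0_norm//; move: H; rewrite ler_norml => /andP[_]; lra.
- by apply: filterS (close _ h12) => t [].
- move=> e e0.
  (* For [e >= 1] the estimate with precision [1 / 2] is better. *)
  have [e1|e1] := ltP e 1.
    by apply: filterS (close e _); [move=> t []|rewrite e0].
  have Hc := close _ h12; near=> t.
  have t0 : 0 < t by near: t; exact: nbhs_right_gt.
  have [_ _ H] : [/\ 0 < qram t, simple_root (Delta ^~ (param_path t)) (qram t) &
       `|qram t - ramified_scale t| <= 2^-1 * ramified_scale t] by near: t.
  rewrite (le_trans H)// ler_wpM2r ?(ltW (ramified_scale_gt0 t0))//; lra.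
Unshelve. all: by end_near. Qed.

End ramified_root.

End path.

(** * The theorem *)

(** The outcome of the construction, without the auxiliary choices it depends on. *)
Lemma root_paths (R : realType) (m n nu : nat)
    (Delta S : R -> 'rV[R]_m -> R) (c d : R)
    (F : nat -> R -> 'rV[R]_m -> R) (k k1 k2 : R -> 'rV[R]_m -> R) (r M : R)
    (ra : 'I_n -> R) :
  (1 < n)%N -> (1 < nu)%N -> local_model n nu Delta S c d F k k1 k2 r M ->
  \rank ('J (coefA n S) 0) = n ->
  (forall j, 0 < ra j) -> (forall i j : 'I_n, (i < j)%N -> ra i < ra j) ->
  exists (p : R -> 'rV[R]_m) (q : 'I_n -> R -> R) (qram : R -> R),
  [/\ (forall e, 0 < e -> \forall t \near 0^'+, `|p t| < e) /\
      \forall t \near 0^'+, {for t, continuous p},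
      forall e, 0 < e -> \forall t \near 0^'+, forall j, `|q j t| < e,
      \forall t \near 0^'+, injective (q ^~ t) /\
        (forall j, q j t < 0 /\ simple_root (Delta ^~ (p t)) (q j t)),
      forall j, q j t / t @[t --> 0^'+] --> - ra j &
      c * d < 0 -> [/\ forall e, 0 < e -> \forall t \near 0^'+, `|qram t| < e,
        \forall t \near 0^'+, 0 < qram t /\ simple_root (Delta ^~ (p t)) (qram t) &
        forall e, 0 < e -> \forall t \near 0^'+,
          `|qram t - ramified_scale nu c d ra t| <= e * ramified_scale nu c d ra t]].
Proof.
move=> n1 nu1 LM rk ra0 ra_lt.
have [sec [r0 [C [r00 C0 sec0 secK secL]]]] := coef_section LM rk.
have [q [q1 q2 q3]] := negative_roots n1 nu1 LM r00 C0 sec0 secK secL ra0 ra_lt.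
have [qram Hq] : exists qram : R -> R, c * d < 0 ->
   [/\ forall e, 0 < e -> \forall t \near 0^'+, `|qram t| < e,
        \forall t \near 0^'+, 0 < qram t /\
          simple_root (Delta ^~ (param_path c sec ra t)) (qram t) &
        forall e, 0 < e -> \forall t \near 0^'+,
          `|qram t - ramified_scale nu c d ra t| <= e * ramified_scale nu c d ra t].
  have [cd|cd] := ltP (c * d) 0; last by exists (fun=> 0).
  have [qram Hq] := ramified_root n1 nu1 LM r00 C0 sec0 secK secL ra0 cd.
  by exists qram.
exists (param_path c sec ra), q, qram; split => //; split.
  by move=> e e0; exact: (param_path_small c r00 C0 sec0 secL ra e0).
apply: filterS (target_small c ra r00) => t.
exact: (param_path_continuous C0 secL).
Qed.

Theorem theorem4p1 (R : realType) (m n nu : nat)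
    (Delta S : R -> 'rV[R]_m -> R) (K : R -> R -> 'rV[R]_m -> R)
    (rhos : R) (Vs : set 'rV[R]_m) :
  (2 <= n)%N -> (2 <= nu)%N -> ~~ odd nu ->
  ramified_displacement n nu Delta S K ->
  0 < rhos -> nbhs (0 : 'rV[R]_m) Vs ->
  let c := coefS S n 0 in
  let d := K 0 0 0 in
  let bound := if 0 < c * d then n else n.+1 in
  [/\ (Cyc rhos Vs Delta <= bound%:R%:E)%E,
      (exists rho : R, exists V : set 'rV[R]_m,
        [/\ 0 < rho <= rhos, nbhs (0 : 'rV[R]_m) V, V `<=` Vs &
            forall p q, V p -> -rho < q < rho -> Delta q p = 0 ->
              isolated [set x | Delta x p = 0] q]) &
      (n <= m)%N -> \rank ('J (coefA n S) 0) = n ->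
      [/\ Cyc rhos Vs Delta = bound%:R%:E,
          (forall (rho : R) (V : set 'rV[R]_m), 0 < rho -> nbhs (0 : 'rV[R]_m) V ->
            exists2 p, V p &
              (bound%:R%:E <=
                 Nsimple (Delta ^~ p) [set q | (- rho < q < rho)%R])%E) &
          forall r : 'I_n -> R,
            (forall j, 0 < r j) ->
            (forall i j : 'I_n, (i < j)%N -> r i < r j) ->
            exists (p : R -> 'rV[R]_m) (q : 'I_n -> R -> R),
              [/\ p t @[t --> 0^'+] --> (0 : 'rV[R]_m),
                  \forall t \near 0^'+, {for t, continuous p},
                  \forall t \near 0^'+, injective (q ^~ t) /\
                    (forall j, q j t < 0 /\
                       simple_root (Delta ^~ (p t)) (q j t)),
                  forall j, q j t / t @[t --> 0^'+] --> - r j &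
                  c * d < 0 ->
                  exists2 qram : R -> R,
                    \forall t \near 0^'+,
                      0 < qram t /\ simple_root (Delta ^~ (p t)) (qram t) &
                    qram ~_(0^'+) (fun t : R =>
                      (`|c / d| * \prod_(j < n) r j) `^ (nu%:R / nu.+1%:R)
                      * t `^ ((n * nu)%:R / nu.+1%:R))]]].
Proof.
move=> n1 nu1 _ RD rhos0 Vn c d bound.
have [F [k [k1 [k2 [r [M LM]]]]]] := ramified_local_model nu1 RD.
rewrite -/c -/d in LM.
have [rho rho0 zb] := local_zeros_bound n1 nu1 LM.
pose rh := Num.min rho rhos.
pose V := Vs `&` [set p : 'rV[R]_m | `|p| < rho].
have rh0 : 0 < rh by rewrite lt_min rho0.
have nV : nbhs (0 : 'rV[R]_m) V.
  apply: filterI => //; apply/(@nbhs_norm0P R 'rV[R]_m).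
  by exists rho.
have cnt p (A : set R) : V p ->
    A `<=` [set q | - rh < q < rh] `&` [set q | Delta q p = 0] ->
    finite_set A /\ ((counting A : \bar R) <= bound%:R%:E)%E.
  move=> [_ pr] AZ; apply: counting_le => s ss sA.
  apply: (zb p pr s ss); apply/allP => q qs.
  have [/= /andP[q1 q2] Dq] := AZ q (sA q qs).
  have rr : rh <= rho by rewrite ge_min lexx.
  rewrite Dq eqxx andbT (lt_le_trans q2)// andbT (le_lt_trans _ q1)// lerN2//.
have Cle : (Cyc rhos Vs Delta <= bound%:R%:E)%E.
  apply: (@le_trans _ _ (ereal_sup [set Niso (Delta ^~ p) [set q | - rh < q < rh] | p in V])).
    apply: ereal_inf_lbound; exists rh, V; split => //.
      by rewrite rh0 ge_min lexx orbT.
    by move=> p [].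
  apply: ge_ereal_sup => _ [p Vp <-].
  by apply: (cnt p _ Vp _).2 => q [qq /isolatedS].
split => //.
  exists rh, V; split => //; first by rewrite rh0 ge_min lexx orbT.
    by move=> p [].
  move=> p q Vp qq Dq; apply: (@finite_isolated R [set x | Delta x p = 0] (- rh) rh) => //.
  by apply: (cnt p _ Vp _).1 => x [Dx xx].
move=> _ rk.
have cd0 : c * d != 0 by rewrite mulf_neq0 ?(lm_c LM) ?(lm_d LM).
have simple (rho' : R) (V' : set 'rV[R]_m) : 0 < rho' -> nbhs (0 : 'rV[R]_m) V' ->
   exists2 p, V' p & (bound%:R%:E <=
                 Nsimple (Delta ^~ p) [set q | (- rho' < q < rho')%R])%E.
  move=> r'0 /(@nbhs_norm0P R 'rV[R]_m)[e /= e0 eV].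
  (* Any increasing family of positive numbers would do. *)
  pose ra (j : 'I_n) : R := j.+1%:R.
  have [||p [q [qram [[p0 _] q1 q2 _ qr]]]] :=
    @root_paths _ _ _ _ _ _ _ _ _ _ _ _ _ _ ra n1 nu1 LM rk.
  - by move=> j; rewrite ltr0n.
  - by move=> i j ij; rewrite ltr_nat ltnS.
  have H1 := p0 e e0; have H2 := q1 rho' r'0.
  have H3 : \forall t \near 0^'+, c * d < 0 -> `|qram t| < rho' /\
      0 < qram t /\ simple_root (Delta ^~ (p t)) (qram t).
    have [cd|cd] := ltP (c * d) 0; last by near=> t.
    by have [h1 h2 _] := qr cd; apply: filterS2 (h1 _ r'0) h2.
  have : \forall t \near (0 : R)^'+, exists2 p, V' p & (bound%:R%:E <=
                 Nsimple (Delta ^~ p) [set q | (- rho' < q < rho')%R])%E.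
    near=> t; exists (p t); first by apply: eV; near: t.
    have qs : forall j, `|q j t| < rho' by near: t.
    have [qi qroot] : injective (q ^~ t) /\
        (forall j, q j t < 0 /\ simple_root (Delta ^~ (p t)) (q j t)) by near: t.
    have hr : c * d < 0 -> `|qram t| < rho' /\
      0 < qram t /\ simple_root (Delta ^~ (p t)) (qram t) by near: t.
    pose s := [seq q j t | j <- enum 'I_n].
    have us : uniq s by rewrite map_inj_uniq ?enum_uniq.
    have sP : {in s, forall x, x < 0 /\ ([set q | - rho' < q < rho'] `&`
       [set q | simple_root (Delta ^~ (p t)) q]) x}.
      move=> x /mapP[j _ ->]; have [? ?] := qroot j; split=> //; split => //=.
      by rewrite -ltr_norml.
    have ss : size s = n by rewrite size_map size_enum_ord.
    rewrite /Nsimple /bound; case: ifPn => [_|ncd].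
      by rewrite -[X in X%:R%:E]ss; apply: counting_ge => // x /sP[].
    have cd : c * d < 0 by rewrite lt_neqAle cd0 leNgt.
    have [h1 [h2 h3]] := hr cd.
    have -> : n.+1 = size (qram t :: s) by rewrite /= ss.
    apply: counting_ge => [/=|x].
      rewrite us andbT; apply/negP => /sP[/(lt_trans h2)]; by rewrite ltxx.
    rewrite inE => /orP[/eqP->|/sP[]//]; split => //=; by rewrite -ltr_norml.
  by move=> /filter_ex[].
split => //.
- apply/le_anti/andP; split => //.
  apply: le_ereal_inf_tmp => _ [rho' [V' [/andP[r'0 _] nV' _ ->]]].
  have [p V'p Hp] := simple rho' V' r'0 nV'.
  apply: (le_trans Hp).
  apply: (@le_trans _ _ (Niso (Delta ^~ p) [set q | - rho' < q < rho'])).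
    by apply: counting_mono => q [qq /simple_root_isolated].
  by apply: ereal_sup_ubound; exists p.
- move=> ra ra0 ra_lt.
  have [p [q [qram [[p0 pc] q1 q2 q3 qr]]]] := root_paths n1 nu1 LM rk ra0 ra_lt.
  exists p, q; split => //.
    apply/cvgrPdist_lt => e e0; apply: filterS (p0 e e0) => t.
    by rewrite sub0r normrN.
  move=> cd; have [_ h2 h3] := qr cd; exists qram => //.
  by apply/eqaddoP => e e0; apply: filterS (h3 e e0) => t h;
     rewrite (le_trans h)// ler_wpM2l ?ler_norm// ltW.
Unshelve. all: by end_near. Qed.
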